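(* Let $\theta\in[0,\tfrac12)$ be such that $\sigma(\theta)$ is periodic under $\sigma$, and put $\theta'=\theta+\tfrac12$. Let $\sim$ be a non-degenerate invariant lamination with $\theta\sim\theta'$. Then: (1) if $\alpha,\beta\in\mathbb{T}$ are such that for every $k\ge 0$ either $\sigma^k(\alpha),\sigma^k(\beta)$ both belong to $[\theta,\theta']$ or they both belong to $[\theta',\theta]$, then $\alpha\sim\beta$; (2) the geometric lamination $\mathcal{L}^\theta_\infty$ generated by pulling back the critical diameter $\ell_\theta=\overline{\theta\theta'}$ is compatible with $\sim$, i.e. the two endpoints of every leaf of $\mathcal{L}^\theta_\infty$ are $\sim$-equivalent; (3) the periodic orbit $A_\theta$ and the set $\{0\}$ are two $\sigma$-invariant $\sim$-classes. In particular, if $\theta$ is basic rotational, then there is no non-degenerate invariant lamination $\sim$ with $\theta\sim\theta'$.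
   Context: $\mathbb{T}=\mathbb{R}/\mathbb{Z}$ is identified with the boundary of the closed unit disk $\mathbb{D}$, and $\sigma:\mathbb{T}\to\mathbb{T}$ is $\sigma(x)=2x\bmod 1$. For $x,y\in\mathbb{T}$, $[x,y]$ is the closed arc running counterclockwise from $x$ to $y$. Laminations. Two closed sets $A,B\subset\mathbb{T}$ are unlinked if their convex hulls in $\mathbb{D}$ are disjoint. A lamination is a closed equivalence relation on $\mathbb{T}$ (closed graph) with nowhere dense classes such that distinct classes are unlinked. The degenerate lamination identifies all points of $\mathbb{T}$. A lamination is invariant if $\sigma(C)$ is a class for every class $C$. Geometric lamination $\mathcal{L}^\theta_\infty$. A leaf is a chord $\overline{ab}$ with $a,b\in\mathbb{T}$ ($a=b$ allowed); $\sigma(\overline{ab})=\overline{\sigma(a)\sigma(b)}$. Two leaves cross if they are distinct and meet inside the open disk. Put $\mathcal{L}^\theta_0=\{\ell_\theta\}$, and let $\mathcal{L}^\theta_{n+1}$ consist of the leaves of $\mathcal{L}^\theta_n$ together with all leaves $\ell$ with $\sigma(\ell)\in\mathcal{L}^\theta_n$ which cross no leaf of $\mathcal{L}^\theta_n$ (sharing endpoints in $\mathbb{T}$ is allowed). $\mathcal{L}^\theta_\infty$ is $\bigcup_n\mathcal{L}^\theta_n$ together with all limits of its leaves (possibly degenerate). Rotational sets. A closed set $E\subset\mathbb{T}$ with $\sigma(E)=E$ is rotational of rotation number $\rho\in[0,1)$ if either $E$ is a periodic orbit and $\sigma|_E$ is conjugate, by an orientation preserving homeomorphism of $\mathbb{T}$,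 to the restriction of the rigid rotation by $\rho$ to the orbit of $0$; or $\rho$ is irrational and $\sigma|_E$ is semiconjugate, by an orientation preserving monotone map $\mathbb{T}\to\mathbb{T}$ (point preimages connected), to the rotation by $\rho$. It is known (Bullett–Sentenac) that for $\theta\in[0,\tfrac12)$ the semicircle $[\theta,\theta']$ contains a unique minimal rotational set, denoted $A_\theta$, and that if $\theta$ is preperiodic then $A_\theta$ is a periodic orbit. The angle $\theta$ is called basic rotational if $\sigma(\theta)$ is periodic and $\{\theta,\theta'\}\cap A_\theta\neq\emptyset$. *)

(* Defs.v *)
From HB Require Import structures.
From mathcomp Require Import all_boot all_order all_algebra.
From mathcomp Require Import all_classical all_reals all_analysis.

Set Implicit Arguments.
Unset Strict Implicit.
Unset Printing Implicit Defensive.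

Set Warnings "-redundant-canonical-projection".

Import Order.TTheory GRing.Theory Num.Theory.
Import numFieldNormedType.Exports.

Local Open Scope classical_set_scope.
Local Open Scope ring_scope.
Local Open Scope quotient_scope.

(* The circle R/Z: the quotient group, with the quotient topology.  Both
   MathComp quotients ([ring_quotient] for the group, [quotient_topology] for
   the topology) live on the same carrier. *)
Definition intZ (R : realType) : zmodClosed R :=
  GRing.ZmodClosed.clone R (@Num.int_num_subdef R) _.

Definition circle (R : realType) : Type :=
  quotient_topology (ring_quotient.Quotient.quot (intZ R)).

HB.instance Definition _ (R : realType) := Topological.on (circle R).
HB.instance Definition _ (R : realType) := Quotient.on (circle R).
HB.instance Definition _ (R : realType) := GRing.isZmodule.Build (circle R)
  (@ring_quotient.Quotient.addqA _ (intZ R))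
  (@ring_quotient.Quotient.addqC _ (intZ R))
  (@ring_quotient.Quotient.add0q _ (intZ R))
  (@ring_quotient.Quotient.addNq _ (intZ R)).

Definition ang {R : realType} (x : R) : circle R := \pi_(circle R) x.

Lemma angD (R : realType) (x y : R) : ang (x + y) = ang x + ang y.
Proof. exact: (@ring_quotient.Quotient.pi_add _ (intZ R)). Qed.

Lemma ang_eq (R : realType) (x y : R) : ang x = ang y <-> x - y \is a Num.int.
Proof.
have := @ring_quotient.Quotient.idealrBE _ (intZ R) x y.
rewrite -[_ \in _]/(x - y \is a Num.int) => ->.
by split=> [xy|/eqP//]; apply/eqP.
Qed.

Section Dynamics.
Variables (T : Type) (f : T -> T).

Definition periodic_pt (x : T) : Prop := exists2 n, (0 < n)%N & iter n f x = x.

Definition orbit_set (x : T) : set T := [set iter n f x | n in [set: nat]].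

Definition periodic_orbit (E : set T) : Prop :=
  exists2 x, periodic_pt x & E = orbit_set x.

End Dynamics.

Section Circle.
Variable R : realType.
Local Notation T := (circle R).
Local Notation plane := (R^o * R^o)%type.
Implicit Types (x y : T) (A B C E : set T).

Definition sigma x : T := x *+ 2.

Definition rotation (rho : R) x : T := x + ang rho.

Definition antipode x : T := x + ang (2^-1 : R).

(* closed arc running counterclockwise from x to y; circle_arc x x = {x} *)
Definition circle_arc x y : set T :=
  [set z | exists s u : R,
     [/\ 0 <= s, s <= u, u < 1, z = x + ang s & y = x + ang u]].

(* The circle as the boundary of the unit disk; [repr x] is any real
   representative of x. *)
Definition circle_pt x : plane :=
  (cos (2 * pi * (repr x : R)), sin (2 * pi * (repr x : R))).

Definition open_disk : set plane := [set p | p.1 ^+ 2 + p.2 ^+ 2 < 1].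

Definition convex_hull (A : set plane) : set plane :=
  smallest (@convex_set R plane) A.

Definition unlinked A B : Prop :=
  convex_hull (circle_pt @` A) `&` convex_hull (circle_pt @` B) = set0.

Definition nowhere_dense A : Prop := interior (closure A) = set0.

Section Laminations.
Variable sim : T -> T -> Prop.

Definition is_class C : Prop := exists x, C = [set y | sim x y].

Definition is_lamination : Prop :=
  [/\ [/\ forall x, sim x x, forall x y, sim x y -> sim y x
        & forall x y z, sim x y -> sim y z -> sim x z],
      closed [set p : T * T | sim p.1 p.2],
      forall C, is_class C -> nowhere_dense C
    & forall C D, is_class C -> is_class D -> C <> D -> unlinked C D].

Definition sigma_invariant : Prop := forall C, is_class C -> is_class (sigma @` C).

Definition degenerate_lam : Prop := forall x y, sim x y.

End Laminations.

(* The leaf with endpoints a and b is encoded by either of the pairs (a, b)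
   and (b, a): sets of leaves are symmetric subsets of T * T, and limits of
   leaves are limits of endpoint pairs. *)
Local Notation leaf := (T * T)%type.

Definition same_leaf (l m : leaf) : Prop := m = l \/ m = (l.2, l.1).

Definition chord (l : leaf) : set plane :=
  convex_hull (circle_pt @` [set l.1; l.2]).

Definition cross (l m : leaf) : Prop :=
  ~ same_leaf l m /\ chord l `&` chord m `&` open_disk !=set0.

Fixpoint geolam (theta : T) (n : nat) : set leaf :=
  if n is n'.+1 then
    geolam theta n' `|`
    [set l | geolam theta n' (sigma l.1, sigma l.2) /\
             forall m, geolam theta n' m -> ~ cross l m]
  else [set (theta, antipode theta); (antipode theta, theta)].

Definition geolam_infty (theta : T) : set leaf :=
  closure (\bigcup_n geolam theta n).

(* f has a degree one nondecreasing lift *)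
Definition orientation_preserving (f : T -> T) : Prop :=
  exists F : R -> R, [/\ continuous F, {homo F : s u / s <= u},
    forall s, F (s + 1) = F s + 1 & forall s, f (ang s) = ang (F s)].

Definition homeomorphism (f : T -> T) : Prop :=
  continuous f /\ exists g, [/\ continuous g, cancel f g & cancel g f].

Definition monotone_map (f : T -> T) : Prop :=
  continuous f /\ forall y, connected (f @^-1` [set y]).

Definition rotational_of (rho : R) E : Prop :=
  [/\ 0 <= rho < 1, closed E, sigma @` E = E &
    (periodic_orbit sigma E /\
     exists h, [/\ homeomorphism h, orientation_preserving h,
       h @` E = orbit_set (rotation rho) 0 &
       forall x, E x -> h (sigma x) = rotation rho (h x)])
    \/
    (~ (exists q : rat, rho = ratr q) /\
     exists h, [/\ monotone_map h, orientation_preserving h,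
       h @` E = setT &
       forall x, E x -> h (sigma x) = rotation rho (h x)])].

Definition rotational E : Prop := exists rho, rotational_of rho E.

(* E is the set A_theta: a rotational set contained in the semicircle
   [theta, theta'], minimal for inclusion.  By Bullett and Sentenac there is
   exactly one such E. *)
Definition is_A (theta : T) E : Prop :=
  [/\ rotational E, E `<=` circle_arc theta (antipode theta) &
      forall E', rotational E' -> E' `<=` E -> E' = E].

Definition basic_rotational (theta : T) : Prop :=
  periodic_pt sigma (sigma theta) /\
  exists A, is_A theta A /\ (A theta \/ A (antipode theta)).

End Circle.

(* Main.v *)
Require Import Defs.
From HB Require Import structures.
From mathcomp Require Import all_boot all_order all_algebra.
From mathcomp Require Import all_classical all_reals all_analysis.
From mathcomp Require Import ring lra zify.

(** Write C for the class of theta, which contains the critical diameter.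
    Everything rests on one remark, [pullback]: if x and y lie in the same
    closed semicircle cut off by the diameter and sigma x ~ sigma y, then
    x ~ y.  Indeed the class of x is mapped onto the class of sigma x, so it
    contains y or its antipode; in the second case it meets both sides of the
    diameter, so by planarity it is C, and C is symmetric because a class
    mapped onto sigma(C) contains theta or theta'.  Assertion (2) follows by
    induction along the construction of the geometric lamination, a leaf that
    does not cross the diameter having both ends in one closed semicircle.

    For (1), let x and y have the same itinerary and suppose that they are not
    equivalent.  Call a point of the arc [x, y] visible if no leaf with ends in
    that arc passes over it.  By planarity and [pullback], sigma maps points
    visible from (x, y) to points visible from (sigma x, sigma y), whichever
    way the image arc turns around the circle; so all visible points have the
    itinerary of x and y ([visible_same_itin]).  Compactness gives a visible
    point between any two inequivalent visible points, hence an infinite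
    sequence of pairwise inequivalent visible points ([visible_sequence]).  On
    the other hand only finitely many points can share an itinerary, up to
    equivalence:
    - if the orbit of the point meets C, then by periodicity of C and
      [pullback] its class is determined by the residue, modulo the period, of
      the time at which it does so ([generic_tail]);
    - two points x, y with the same itinerary whose orbits avoid C are never
      almost antipodal: they would be close to theta and theta', their images
      close to sigma(theta) on opposite sides, and after one period they would
      be separated by the diameter ([antipodal_gap]).  Hence if their k-th
      images are close, x and y are 2^k times closer.  Among many such points
      two have k-th images close to each other, for every k, which is absurd
      ([no_generic_sequence]).

    For (3), sigma(C) <> C, since otherwise C would be backward invariant,
    hence dense and closed ([crit_not_fixed]).  So an invariant class lies in
    one of the two open semicircles.  In the one containing 0 the only point
    whose orbit stays there is 0, because doubling is expanding.  In the other
    one, sigma is injective on an invariant class Q and preserves the cyclic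
    order; Q is finite by the previous paragraph.  The gap to the right of a
    point of Q doubles in length under sigma unless the point is the rightmost
    point M of Q, so the orbit of every point of Q reaches M and Q is a single
    periodic orbit ([invariant_class_cyclic]).  The points of A_theta have the
    same itinerary, so by (1) A_theta lies in such a class Q; being invariant,
    it is equal to Q.  In particular A_theta contains neither theta nor
    theta', whence the last assertion.

    The argument is carried out on the universal cover, where arcs become
    intervals and the cyclic order becomes the order of the line. *)

Set Implicit Arguments.
Unset Strict Implicit.
Unset Printing Implicit Defensive.

Import Order.TTheory GRing.Theory Num.Theory.
Import numFieldNormedType.Exports.

Local Open Scope classical_set_scope.
Local Open Scope ring_scope.

(** * Laminations on the universal cover and the critical class *)

Lemma int_eq0_lt1 (R : realDomainType) (m : int) :
  -1 < m%:~R :> R -> m%:~R < 1 :> R -> m = 0.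
Proof.
move=> m_gt m_lt.
have : -1 < m by rewrite -(ltr_int R).
have : m < 1 by rewrite -(ltr_int R).
by lia.

Qed.

Lemma int_parity (m : int) : exists h : int, m = h * 2 \/ m = h * 2 + 1.
Proof. by exists (divz m 2); lia. Qed.

Lemma exp2_large (R : realType) (x : R) :
  exists K, forall k, (K <= k)%N -> x < 2 ^+ k.
Proof.
exists (Num.bound `|x|) => k Kk; apply: (le_lt_trans (ler_norm x)).
rewrite (lt_trans (archi_boundP (normr_ge0 x)))// -natrX ltr_nat.
by rewrite (leq_ltn_trans Kk)// ltn_expl.
Qed.

(** The relation [r s t := sim (ang s) (ang t)] induced on the line by an
    invariant lamination in which t0 and t0 + 1/2 are equivalent. [r_unlinked]
    is planarity for four points in cyclic order, and [r_half] is invariance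
    read backwards: the class of s is mapped onto the class of 2s, so it
    contains one of the two preimages of 2t. The last field says that n is a
    period of sigma(theta). *)
Record lamination_lift (R : realType) (t0 : R) (n : nat)
    (r : R -> R -> Prop) : Prop := LaminationLift {
  r_refl : forall s, r s s;
  r_sym : forall s t, r s t -> r t s;
  r_trans : forall s t u, r s t -> r t u -> r s u;
  r_int : forall s (m : int), r s (s + m%:~R);
  r_closed : closed [set p : R * R | r p.1 p.2];
  r_unlinked : forall s u t v,
    s < u -> u < t -> t < v -> v < s + 1 -> r s t -> r u v -> r s u;
  r_double : forall s t, r s t -> r (2 * s) (2 * t);
  r_half : forall s t, r (2 * s) (2 * t) -> r s t \/ r s (t + 2^-1);
  r_diameter : r t0 (t0 + 2^-1);
  r_proper : exists s, ~ r s t0;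
  r_period : (0 < n)%N /\ exists m : int, 2 ^+ n * (2 * t0) = 2 * t0 + m%:~R }.

Section RealLine.
Variables (R : realType) (t0 : R) (n : nat) (r : R -> R -> Prop).
Hypothesis L : lamination_lift t0 n r.
Implicit Types (s t u v w z e : R) (m q : int).

(** The lifts of theta and theta'. *)
Definition diam_end e := exists q, e = t0 + q%:~R / 2.

Lemma diam_end_crit e : diam_end e -> r e t0.
Proof.
case=> q ->; have [h [->|->]] := int_parity q.
  apply: (r_sym L).
  by rewrite intrM mulfK ?pnatr_eq0//; apply: (r_int L).
apply: (r_sym L); apply: (r_trans L (r_diameter L)).
have -> : t0 + (h * 2 + 1)%:~R / 2 = t0 + 2^-1 + h%:~R :> R.
  by rewrite intrD intrM; lra.
exact: (r_int L).
Qed.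

Lemma diam_end_shift e m : diam_end e -> diam_end (e + m%:~R / 2).
Proof. by case=> q ->; exists (q + m); rewrite intrD; lra. Qed.

Lemma diam_end_double e : diam_end e <-> exists m, 2 * e = 2 * t0 + m%:~R.
Proof. by split=> -[m E]; exists m; lra. Qed.

Lemma diam_end_iter e : diam_end e -> diam_end (2 ^+ n * e).
Proof.
move=> /diam_end_double[m E]; have [_ [m' E']] := r_period L.
apply/diam_end_double; exists (m' + 2 ^+ n * m).
rewrite mulrCA E mulrDr E' intrD intrM -addrA; congr (_ + (_ + _ * _)).
by rewrite rmorphXn.
Qed.

Lemma r_shiftl s m t : r (s + m%:~R) t <-> r s t.
Proof.
split => H; first exact: (r_trans L (r_int L s m) H).
exact: (r_trans L (r_sym L (r_int L s m)) H).
Qed.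

Lemma r_shiftr s m t : r s (t + m%:~R) <-> r s t.
Proof.
by split=> /(r_sym L) H; apply: (r_sym L);
  [exact/(r_shiftl t m)|exact/(r_shiftl t m s)].
Qed.

Lemma r_double_shiftr s t m : r (2 * s) (2 * (t + m%:~R)) <-> r (2 * s) (2 * t).
Proof.
have -> : 2 * (t + m%:~R) = 2 * t + (2 * m)%:~R by rewrite intrM mulrDr.
exact: r_shiftr.
Qed.

(** The critical class is the full preimage of its image: a class mapped onto
    that image contains a preimage of sigma(theta), that is theta or theta'. *)
Lemma crit_full t : r (2 * t) (2 * t0) -> r t t0.
Proof.
move=> /(r_half L)[//|H].
by apply: (r_trans L H); apply: (r_sym L); exact: (r_diameter L).
Qed.

Lemma crit_antipode t : r (t + 2^-1) t0 -> r t t0.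
Proof.
move=> /(r_double L); rewrite mulrDr divff ?pnatr_eq0// -[1]/(1%:~R) r_shiftl.
exact: crit_full.
Qed.

(** The projections of s and t lie in the same closed semicircle bounded by
    theta and theta'; e is the first end of a lift of that semicircle. *)
Definition same_side s t := exists e m,
  [/\ diam_end e, e <= s <= e + 2^-1 & e <= t + m%:~R <= e + 2^-1].

(** Otherwise the class of s contains the antipode of t, which lies on the other
    side of the diameter; by planarity the class is then the critical one, and
    the antipode of t can be replaced with t. *)
Lemma pullback s t : same_side s t -> r (2 * s) (2 * t) -> r s t.
Proof.
case=> e [m [ge se te]] H; apply/(r_shiftr _ m); move: te H.
rewrite -(r_double_shiftr _ _ m); move: (t + _) => {m}t te H.
have e0 : r e t0 by apply: diam_end_crit.
have e1 : r (e + 2^-1) t0.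
  by apply: diam_end_crit; have := diam_end_shift 1 ge; rewrite div1r.
have [//|H'] := r_half L H.
have [st|st] := pselect (r s t0).
  apply: (r_trans L st); apply: (r_sym L); apply: crit_antipode.
  exact: (r_trans L (r_sym L H')).
have tt : ~ r (t + 2^-1) t0 by move=> tt; apply: st; exact: (r_trans L H').
case: st; apply: (r_sym L); apply: (r_trans L (r_sym L e0)).
have ne a b : r a t0 -> ~ r b t0 -> a != b by move=> Ha Hb; apply/eqP=> E;
  rewrite E in Ha.
have ns : ~ r s t0 by move=> st; apply: tt; exact: (r_trans L (r_sym L H')).
have E1 := ne _ _ e0 ns; have E2 := ne _ _ e1 ns; have E3 := ne _ _ e1 tt.
have e2 : r (e + 2^-1 + 2^-1) t0.
  by apply: diam_end_crit; have := diam_end_shift 2 ge; congr diam_end; lra.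
have E4 := ne _ _ e2 tt.
apply: (@r_unlinked _ _ _ _ L e s (e + 2^-1) (t + 2^-1)) => //.
- by rewrite lt_neqAle E1; lra.
- by rewrite lt_neqAle eq_sym E2; lra.
- by rewrite lt_neqAle E3; lra.
- suff : t + 2^-1 < e + 2^-1 + 2^-1 by lra.
  by rewrite lt_neqAle eq_sym E4; lra.
exact: (r_trans L e0 (r_sym L e1)).
Qed.

(** If the critical class were mapped to itself, it would contain all preimages
    of its points, in particular the dense set of all t0 + j / 2^k; being
    closed, it would be the whole circle. *)
Lemma crit_not_fixed : ~ r (2 * t0) t0.
Proof.
move=> fix0; have [s []] := r_proper L.
have crit s' : r (2 * s') t0 -> r s' t0.
  by move=> H; apply: crit_full; apply: (r_trans L H); apply: (r_sym L).
have critk k s' : r (2 ^+ k * s') t0 -> r s' t0.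
  elim: k s' => [|k IH] s'; first by rewrite mul1r.
  by rewrite exprSr -mulrA => /IH /crit.
(* these points are mapped into the critical class after k doublings *)
have dyadic k (j : int) : r (t0 + j%:~R / 2 ^+ k) t0.
  apply: (critk k); rewrite mulrDr mulrCA divff ?expf_neq0 ?pnatr_eq0// mulr1.
  apply/r_shiftl; elim: k => [|k IH]; first by rewrite mul1r; exact: (r_refl L).
  rewrite exprS -mulrA; apply: (r_trans L _ fix0); exact: (r_double L).
suff H : [set p : R * R | r p.1 p.2] (s, t0) by [].
rewrite ((closure_id _).1 (r_closed L)) => B /nbhs_ballP[d d0 dB].
have [k /(_ k (leqnn k)) kd] := exp2_large d^-1.
have p0 : 0 < 2 ^+ k :> R by rewrite exprn_gt0.
set x := (s - t0) * 2 ^+ k; pose j := Num.floor x.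
exists (t0 + j%:~R / 2 ^+ k, t0); split; first exact: dyadic.
apply: dB; split => /=; last exact: ballxx.
rewrite -ball_normE/= opprD addrA -[s - t0](mulfK (lt0r_neq0 p0)) -/x -mulrBl.
have /andP[jx xj] := floor_itv x.
rewrite intrD -/j in jx xj.
rewrite normrM (gtr0_norm (x := _^-1)) ?invr_gt0// ltr_pdivrMr//.
rewrite ger0_norm ?subr_ge0// (@lt_trans _ _ 1) ?ltrBlDr 1?addrC//.
by rewrite mulrC -ltr_pdivrMr// mul1r.
Qed.

End RealLine.

(** * Itineraries and visible points *)

Section Itineraries.
Variables (R : realType) (t0 : R) (n : nat) (r : R -> R -> Prop).
Hypothesis L : lamination_lift t0 n r.
Implicit Types (s t u v w z e X Y : R) (m q : int).
Local Notation diam_end := (diam_end t0).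
Local Notation same_side := (same_side t0).

Lemma same_side_shiftr s t m : same_side s (t + m%:~R) <-> same_side s t.
Proof.
split=> -[e [q [ge se te]]].
  by exists e, (m + q); split => //; rewrite intrD; lra.
by exists e, (q - m); split => //; rewrite intrB; lra.
Qed.

Lemma same_side_sym s t : same_side s t -> same_side t s.
Proof.
case=> e [m [ge se te]]; exists (e - m%:~R), (- m); split.
- by have := diam_end_shift (- (m * 2)) ge; congr diam_end;
    rewrite mulrNz intrM; lra.
- lra.
- by rewrite rmorphN/=; lra.
Qed.

Lemma same_side_shiftl s t m : same_side (s + m%:~R) t <-> same_side s t.
Proof.
by split=> /same_side_sym H; apply/same_side_sym;
  [exact/(same_side_shiftr _ _ m)|exact/same_side_shiftr].
Qed.

Definition same_itin s t := forall k, same_side (2 ^+ k * s) (2 ^+ k * t).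

Lemma same_itin_sym s t : same_itin s t -> same_itin t s.
Proof. by move=> I k; apply/same_side_sym. Qed.

Lemma same_itin_double s t : same_itin s t -> same_itin (2 * s) (2 * t).
Proof. by move=> I k; rewrite !mulrA -exprSr. Qed.

Lemma same_itin_shiftr s t m : same_itin s (t + m%:~R) <-> same_itin s t.
Proof.
have E k : 2 ^+ k * (t + m%:~R) = 2 ^+ k * t + (2 ^+ k * m)%:~R.
  by rewrite mulrDr intrM rmorphXn.
by split=> I k; have := I k; rewrite E same_side_shiftr.
Qed.

Lemma pullback_iter s t k : same_itin s t -> r (2 ^+ k * s) (2 ^+ k * t) ->
  r s t.
Proof.
elim: k => [|k IH] I; first by rewrite !mul1r.
by rewrite !exprS -!mulrA => /(pullback L (I k)); exact: IH.
Qed.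

(** An interval [X, Y] of length less than 1 with X in [e, e + 1/2] meets the
    lifts of the closed semicircle starting at e only in these two sectors. *)
Definition in_sectors e z :=
  e <= z <= e + 2^-1 \/ e + 1 <= z <= e + 1 + 2^-1.

Lemma sectors_same_side e s t : diam_end e -> in_sectors e s ->
  in_sectors e t -> same_side s t.
Proof.
have H w z : diam_end e -> e <= w <= e + 2^-1 -> in_sectors e z ->
  same_side w z.
  move=> ge sw [sz|sz]; first by exists e, 0; rewrite addr0.
  by exists e, (- 1); rewrite rmorphN/=; split => //; lra.
move=> ge [se|se] te; first exact: H.
by rewrite -(addrNK 1 s); apply/(same_side_shiftl (s - 1) t 1);
  apply: H => //; lra.
Qed.

Lemma same_side_sectors s t : s < t < s + 1 -> same_side s t ->
  exists e, [/\ diam_end e, e <= s <= e + 2^-1 & in_sectors e t].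
Proof.
move=> st [e [m [ge se te]]]; exists e; split => //.
have m1 : m < 1 by rewrite -(ltr_int R) rmorph1; lra.
have m2 : - 2 < m by rewrite -(ltr_int R) rmorphN/=; lra.
have [m0|m0] : m = 0 \/ m = - 1 by lia.
  by left; rewrite m0 addr0 in te.
by right; rewrite m0 rmorphN/= in te; lra.
Qed.

(** The points of [X, Y] that no leaf with both ends in [X, Y] hides from the
    chord joining X to Y. *)
Definition visible X Y z := X <= z <= Y /\
  forall u v, X <= u -> u < z -> z < v -> v <= Y -> ~ r u v.

(** If the arc from X to Y stays in a semicircle, doubling is injective on it
    and leaves of the image arc pull back. If it is the complementary arc that
    stays in the semicircle, the part of [X, Y] outside the semicircle is hidden
    by a copy of the diameter; doubling glues the two remaining pieces at the
    critical value into the arc from 2X to 2Y - 1, and leaves of that arc again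
    pull back, to leaves joining points of the two pieces. *)
Lemma visible_double X Y : X < Y < X + 1 -> same_itin X Y -> ~ r X Y ->
  exists X' Y', [/\ X' < Y' < X' + 1, same_itin X' Y', ~ r X' Y' &
    exists2 e, diam_end e & forall z, visible X Y z -> in_sectors e z /\
      exists m, visible X' Y' (2 * z + m%:~R)].
Proof.
move=> XY I nr; have S : same_side X Y by have := I 0; rewrite !mul1r.
have [e [ge Xe Ye]] := same_side_sectors XY S.
have nr2 : ~ r (2 * X) (2 * Y) by move=> /(pullback L S).
have ge1 : diam_end (e + 2^-1) by have := diam_end_shift 1 ge; rewrite div1r.
have ge2 : diam_end (e + 1) by have := diam_end_shift 2 ge; rewrite divff.
have rg a b : diam_end a -> diam_end b -> r a b.
  by move=> ga gb; apply: (r_trans L (diam_end_crit L ga));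
    exact: (r_sym L (diam_end_crit L gb)).
(* first the arc from X to Y inside the semicircle, then its complement *)
case: Ye => Ye.
  have XY2 : Y < X + 2^-1.
    have [//|H] := ltP Y (X + 2^-1); case: nr.
    have -> : X = e by lra.
    have -> : Y = e + 2^-1 by lra.
    exact: rg.
  exists (2 * X), (2 * Y); split => //; [lra|exact: same_itin_double|].
  exists e => // z [Xz vz]; split; first by left; lra.
  exists 0; rewrite addr0; split; first by lra.
  move=> u v Xu uz zv vY uv.
  have := vz (u / 2) (v / 2); apply; try lra.
  apply: (pullback L); last by congr r: uv; lra.
  by apply: (@sectors_same_side e) => //; left; lra.
have XY2 : X + 2^-1 < Y.
  have [//|H] := ltP (X + 2^-1) Y; case: nr.
  have -> : X = e + 2^-1 by lra.
  have -> : Y = e + 1 by lra.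
  exact: rg.
exists (2 * X), (2 * Y + (-1)%:~R); split => //.
- by rewrite rmorphN/=; lra.
- by apply/same_itin_shiftr; exact: same_itin_double.
- by move=> /(r_shiftr L).
exists e => // z [Xz vz].
have split_z : z <= e + 2^-1 \/ e + 1 <= z.
  have [zl|zl] := leP z (e + 2^-1); first by left.
  have [zr|zr] := leP (e + 1) z; first by right.
  by case: (vz (e + 2^-1) (e + 1)); try lra; exact: rg.
split; first by rewrite /in_sectors; lra.
have lift w : 2 * X <= w <= 2 * Y - 1 -> exists u,
    (2 * u = w /\ w <= 2 * e + 1) \/ (2 * u = w + 1 /\ 2 * e + 1 < w).
  move=> wXY; have [we|we] := leP w (2 * e + 1).
    by exists (w / 2); left; split => //; lra.
  by exists ((w + 1) / 2); right; split => //; lra.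
have lift_vis w1 w2 z' : (2 * z = z' /\ z <= e + 2^-1) \/ (2 * z = z' + 1 /\ e + 1 <= z) ->
    2 * X <= w1 -> w1 < z' -> z' < w2 -> w2 <= 2 * Y - 1 -> ~ r w1 w2.
  move=> zz' Xw1 w1z zw2 w2Y w12.
  have [|u hu] := lift w1; first by lra.
  have [|v hv] := lift w2; first by lra.
  apply: (vz u v); try lra; apply: (pullback L).
    by apply: (@sectors_same_side e) => //; rewrite /in_sectors; lra.
  have hr a b : a = b \/ a = b + 1%:~R -> r a b.
    by case=> ->; [exact: (r_refl L)|exact/(r_sym L)/(r_int L)].
  have r1 : r (2 * u) w1 by apply: hr; rewrite /=; lra.
  have r2 : r (2 * v) w2 by apply: hr; rewrite /=; lra.
  by apply: (r_trans L r1); apply: (r_trans L w12); exact: (r_sym L r2).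
case: split_z => hz; [exists 0|exists (- 1)]; rewrite ?rmorphN ?rmorph1 /=;
  split; try lra;
  move=> w1 w2; apply: lift_vis; lra.
Qed.

(** Points visible from (X, Y) lie in the same closed semicircle as X and Y, and
    they remain visible under iteration. *)
Lemma visible_same_itin X Y z1 z2 : X < Y < X + 1 -> same_itin X Y -> ~ r X Y ->
  visible X Y z1 -> visible X Y z2 -> same_itin z1 z2.
Proof.
move=> XY I nr v1 v2 k;
  elim: k X Y z1 z2 XY I nr v1 v2 => [|k IH] X Y z1 z2 XY I nr.
  have [X' [Y' [_ _ _ [e ge V]]]] := visible_double XY I nr.
  by move=> /V[e1 _] /V[e2 _]; rewrite !mul1r; exact: sectors_same_side e1 e2.
have [X' [Y' [XY' I' nr' [e ge V]]]] := visible_double XY I nr.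
move=> /V[_ [m1 V1]] /V[_ [m2 V2]].
have := IH _ _ _ _ XY' I' nr' V1 V2.
rewrite !mulrDr !mulrA -exprSr.
have E m : 2 ^+ k * m%:~R = (2 ^+ k * m)%:~R :> R by rewrite intrM rmorphXn.
by rewrite !E same_side_shiftr same_side_shiftl.
Qed.

End Itineraries.

(** * Many visible points between inequivalent ends *)

Lemma iterated_choice (T : Type) (S : set T) (rho : T -> T -> Prop) :
  S !=set0 -> (forall x, S x -> exists2 y, S y & rho x y) ->
  exists z : nat -> T, forall i, S (z i) /\ rho (z i) (z i.+1).
Proof.
move=> [x0 Sx0] next.
have [|f fP] := @choice T T (fun x y => S x -> S y /\ rho x y).
  move=> x.
  have [/next[y Sy xy]|nSx] := pselect (S x); first by exists y.
  by exists x.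
have Sz i : S (iter i f x0) by elim: i => //= i /fP[].
by exists (fun i => iter i f x0) => i; split => //; exact: (fP _ (Sz i)).2.
Qed.

Section Visibility.
Variables (R : realType) (t0 : R) (n : nat) (r : R -> R -> Prop).
Hypothesis L : lamination_lift t0 n r.
Implicit Types (s t u v w z e X Y : R) (m q : int).

(** The graph of r is closed, so a widest leaf exists in a given rectangle of
    pairs of ends. *)
Lemma widest_pair a b c d u0 v0 :
  a <= u0 <= b -> c <= v0 <= d -> r u0 v0 ->
  exists u v, [/\ a <= u <= b, c <= v <= d, r u v &
    forall u' v', a <= u' <= b -> c <= v' <= d -> r u' v' -> v' - u' <= v - u].
Proof.
move=> abu cdv r0.
pose K := (`[a, b] `*` `[c, d]) `&` [set p : R * R | r p.1 p.2].
have Kcompact : compact K.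
  apply: compact_closedI; last exact: r_closed L.
  by apply: compact_setX; exact: segment_compact.
have Kne : K !=set0 by exists (u0, v0); split => //=; rewrite !in_itv.
have width_cont : {within K, continuous (fun p : R * R => p.2 - p.1)}.
  apply: continuous_subspaceT => p.
  by apply: cvgB; [exact: cvg_snd|exact: cvg_fst].
have [[u v] /set_mem[[/=]]] := compact_EVT_max Kne Kcompact width_cont.
rewrite !in_itv/= => abu' cdv' uv max; exists u, v; split => // u' v' hu hv huv.
by apply: (max (u', v')); apply/mem_set; split => //=; rewrite !in_itv.
Qed.

(** Let p be the last point of [a, b] equivalent to a, and q the first point of
    [p, b] equivalent to b. If every point between p and q were hidden, a widest
    leaf over the midpoint of [p, q] would have to join p to q: a leaf over one
    of its ends would be wider or would cross it, and two crossing leaves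
    combine into a wider one. *)
Lemma visible_between X Y a b : X < Y < X + 1 ->
  visible r X Y a -> visible r X Y b -> a < b -> ~ r a b ->
  exists f, [/\ visible r X Y f, a < f < b, ~ r a f & ~ r f b].
Proof.
move=> XY [Xa va] [Xb vb] ab nab.
have [|||a' [p [a'a a'b rap maxp]]] := @widest_pair a a a b a a.
- lra.
- lra.
- exact: (r_refl L).
have {a'a} a'a : a' = a by lra.
subst a'.
have pmax w : a <= w <= b -> r a w -> w <= p.
  by move=> hw raw; have := maxp a w ltac:(lra) hw raw; lra.
have [|||q [b' [q_itv b'b rqb minq]]] := @widest_pair p b b b b b.
- lra.
- lra.
- exact: (r_refl L).
have {b'b} b'b : b' = b by lra.
subst b'.
have qmin w : p <= w <= b -> r w b -> q <= w.
  by move=> hw rwb; have := minq w b hw ltac:(lra) rwb; lra.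
have npq : ~ r p q.
  by move=> rpq; apply: nab; apply: (r_trans L rap); exact: (r_trans L rpq).
have pq : p < q.
  rewrite lt_neqAle; apply/andP; split; last by lra.
  by apply/eqP => E; apply: npq; rewrite E; exact: (r_refl L).
have [[f vf pfq]|nov] := pselect (exists2 f, visible r X Y f & p < f < q).
  exists f; split => //; first by lra.
  - by move=> raf; have := pmax f ltac:(lra) raf; lra.
  - by move=> rfb; have := qmin f ltac:(lra) rfb; lra.
have cover w : p < w < q ->
    exists u v, [/\ p <= u, u < w, w < v, v <= q & r u v].
  move=> pwq.
  have [u [v [Xu uw wv vY ruv]]] : exists u v, [/\ X <= u, u < w, w < v,
    v <= Y & r u v].
    apply: contrapT => H; apply: nov; exists w => //; split; first by lra.
    by move=> u v Xu uw wv vY ruv; apply: H; exists u, v.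
  have au : a <= u.
    by have [//|ua] := leP a u; case: (va u v) => //; lra.
  have vb' : v <= b.
    by have [//|bv] := leP v b; case: (vb u v) => //; lra.
  have pu : p <= u.
    have [//|up] := leP p u.
    suff rau : r a u by have := pmax v ltac:(lra) (r_trans L rau ruv); lra.
    have [->|ne] := eqVneq a u; first exact: (r_refl L).
    apply: (@r_unlinked _ _ _ _ L a u p v) => //; lra.
  have vq : v <= q.
    have [//|qv] := leP v q.
    suff rvb : r v b by have := qmin u ltac:(lra) (r_trans L ruv rvb); lra.
    have [->|ne] := eqVneq v b; first exact: (r_refl L).
    have ruq : r u q.
      apply: (@r_unlinked _ _ _ _ L u q v b) => //; lra.
    apply: (r_trans L (r_sym L ruv)); exact: (r_trans L ruq).
  by exists u, v.
pose w0 := (p + q) / 2.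
have [|||u [v [hu hv ruv maxuv]]] := @widest_pair p w0 w0 q w0 w0.
- by rewrite /w0; lra.
- by rewrite /w0; lra.
- exact: (r_refl L).
have w0pq : p < w0 < q by rewrite /w0; lra.
(* u cannot be inside (p, q), as a leaf hiding it would contradict the choice of
   the widest one; likewise for v *)
have up : u = p.
  apply/eqP; rewrite -[_ == _]negbK; apply/negP => ne.
  have pu : p < u by rewrite lt_neqAle eq_sym ne; lra.
  have [|u' [v' [pu' u'u uv' v'q ru'v']]] := cover u; first by lra.
  have [vv'|v'v] := leP v v'.
    by have := maxuv u' v' ltac:(lra) ltac:(lra) ru'v'; lra.
  have : r u' v.
    apply: (r_trans L _ ruv).
    by apply: (@r_unlinked _ _ _ _ L u' u v' v) => //; lra.
  by move=> H; have := maxuv u' v ltac:(lra) ltac:(lra) H; lra.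
have vq : v = q.
  apply/eqP; rewrite -[_ == _]negbK; apply/negP => ne.
  have qv : v < q by rewrite lt_neqAle ne; lra.
  have [|u' [v' [pu' u'v vv' v'q ru'v']]] := cover v; first by lra.
  have [u'u|uu'] := leP u' u.
    by have := maxuv u' v' ltac:(lra) ltac:(lra) ru'v'; lra.
  have : r u u'.
    by apply: (@r_unlinked _ _ _ _ L u u' v v') => //; lra.
  by move=> H; have := maxuv u v' ltac:(lra) ltac:(lra) (r_trans L H ru'v');
    lra.
by case: npq; rewrite -up -vq.
Qed.

(** The points descend towards X, each inequivalent to the preceding one and to
    X; a leaf joining two terms that are not consecutive would pass over a
    visible term in between. *)
Lemma visible_sequence X Y : X < Y < X + 1 -> ~ r X Y ->
  exists z : nat -> R, (forall i, visible r X Y (z i)) /\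
    forall i j, (i < j)%N -> ~ r (z j) (z i).
Proof.
move=> XY nXY.
have visX : visible r X Y X by split; [lra|move=> u v; lra].
have visY : visible r X Y Y by split; [lra|move=> u v; lra].
pose S := [set w | [/\ visible r X Y w, X < w & ~ r X w]].
have [||z zP] := @iterated_choice R S (fun x y => y < x /\ ~ r y x).
- by exists Y; split => //; lra.
- move=> w [vw Xw nXw].
  have [f [vf Xfw nXf nfw]] := visible_between XY visX vw Xw nXw.
  by exists f; split => //; lra.
exists z; split=> [i|i j ij]; first by have [[]] := zP i.
have dec k l : (k <= l)%N -> z l <= z k.
  move=> /subnK<-; elim: (l - k)%N => // d IH.
  by apply: le_trans IH; rewrite addSn; have [_ [/ltW]] := zP (d + k)%N.
have [_ [lt1 n1]] := zP i.
have [->//|ne] := eqVneq j i.+1.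
have lt2 : z j < z i.+1.
  have ij2 : (i.+2 <= j)%N by rewrite ltn_neqAle eq_sym ne.
  by apply: le_lt_trans (dec _ _ ij2) _; have [_ []] := zP i.+1.
have [[[_ vis] _ _] _] := zP i.+1; apply: vis => //.
- by have [[[]]] := zP j; lra.
- by have [[[]]] := zP i; lra.
Qed.

End Visibility.

(** * Few points share an itinerary *)

Section Recurrence.
Variables (R : realType) (t0 : R) (n : nat) (r : R -> R -> Prop).
Hypothesis L : lamination_lift t0 n r.
Implicit Types (s t u v w z e X Y : R) (m q : int).
Local Notation diam_end := (diam_end t0).
Local Notation same_itin := (same_itin t0).

(** The orbit of s avoids the critical class. *)
Definition generic s := forall k, ~ r (2 ^+ k * s) t0.

Lemma generic_double s : generic s -> generic (2 * s).
Proof. by move=> gs k; rewrite mulrA -exprSr. Qed.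

(** Distance less than eps on the circle. *)
Definition circle_near eps s t := exists m, `|s - t - m%:~R| < eps.

(** Two points that are almost antipodal and lie in one closed semicircle are
    close to its two ends e and e + 1/2, inside it. One period later the ends
    have a common image, which is theta or theta', and the points are on
    opposite sides of it, close to it: they are separated by the diameter. *)
Lemma antipodal_gap s t m : same_itin s t -> generic s -> generic t ->
  (2 ^+ n.+2)^-1 <= `|s - t - m%:~R - 2^-1|.
Proof.
have key s' t' e : diam_end e -> same_itin s' t' -> generic s' -> generic t' ->
    e <= s' <= e + 2^-1 -> e <= t' <= e + 2^-1 ->
      s' - t' <= 2^-1 - (2 ^+ n.+2)^-1.
  move=> ge I gs gt se te; rewrite leNgt; apply/negP => far.
  have rg a : diam_end a -> s' <> a /\ t' <> a.
    move=> /(diam_end_crit L) ra; split=> E.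
      by apply: (gs 0); rewrite mul1r E.
    by apply: (gt 0); rewrite mul1r E.
  have ge1 : diam_end (e + 2^-1) by have := diam_end_shift 1 ge; rewrite div1r.
  have [_ /eqP te0] := rg _ ge.
  have [/eqP se1 _] := rg _ ge1.
  pose f := 2 ^+ n * (e + 2^-1).
  have gf : diam_end f by exact: diam_end_iter L _ ge1.
  pose eta1 := 2 ^+ n * (e + 2^-1 - s').
  pose eta2 := 2 ^+ n * (t' - e).
  have p0 : 0 < 2 ^+ n :> R by rewrite exprn_gt0.
  have eta1_gt0 : 0 < eta1 by rewrite mulr_gt0//; lra.
  have eta2_gt0 : 0 < eta2 by rewrite mulr_gt0//; lra.
  have eta_small : eta1 + eta2 < 4^-1.
    rewrite -mulrDr -ltr_pdivlMl// -invfM.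
    have -> : 2 ^+ n * 4 = 2 ^+ n.+2 :> R by rewrite !exprS; lra.
    by lra.
  have [n_gt0 _] := r_period L.
  have [h hE] : exists h : int, 2 ^+ n = 2 * h%:~R :> R.
    by case: n n_gt0 => // n' _; exists (2 ^+ n'); rewrite exprS rmorphXn.
  (* one period later the two points are at f - eta1 and f + eta2, up to an
   integer, and f is again an end of the diameter *)
  have S : same_side t0 (f - eta1) (f + eta2).
    have := I n.
    have -> : 2 ^+ n * s' = f - eta1 by rewrite /f /eta1; lra.
    have -> : 2 ^+ n * t' = f + eta2 + (- h)%:~R.
      by rewrite mulrNz /f /eta2; lra.
    by rewrite same_side_shiftr.
  have [e' [m' [ge' fe' fe'']]] := S.
  have [q fE] : exists q, f = e' + q%:~R / 2.
    by case: gf ge' => q1 -> [q2 ->]; exists (q1 - q2); rewrite intrB; lra.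
  have q1 : 0 < q by rewrite -(ltr_int R) mulr0z; lra.
  have q2 : q < 2 by rewrite -(ltr_int R); lra.
  have {}q1 : q = 1 by clear - q1 q2; lia.
  rewrite {}q1 in fE.
  have m1 : m' < 0 by rewrite -(ltr_int R) mulr0z; lra.
  have m2 : - 1 < m' by rewrite -(ltr_int R) mulrNz; lra.
  by clear - m1 m2; lia.
move=> I gs gt; have [e [m' [ge se te]]] : same_side t0 s t by have := I 0;
  rewrite !mul1r.
have gt' : generic (t + m'%:~R).
  move=> k; have -> : 2 ^+ k * (t + m'%:~R) = 2 ^+ k * t + (2 ^+ k * m')%:~R.
    by rewrite mulrDr intrM rmorphXn.
  by rewrite (r_shiftl L).
have I1 : same_itin s (t + m'%:~R) by apply/same_itin_shiftr.
have k1 := key _ _ _ ge I1 gs gt' se te.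
have k2 := key _ _ _ ge (same_itin_sym I1) gt' gs te se.
have p0 : 0 < (2 ^+ n.+2)^-1 :> R by rewrite invr_gt0 exprn_gt0.
move: k1 k2 p0; set d := 2 ^- n.+2 => k1 k2 p0.
rewrite leNgt; apply/negP; rewrite ltr_norml => close.
have b1 : m - m' < 0 by rewrite -(ltr_int R) intrB mulr0z; lra.
have b2 : - 1 < m - m' by rewrite -(ltr_int R) intrB mulrNz; lra.
by clear - b1 b2; lia.
Qed.

(** If 2s and 2t are close on the circle, then s and t are close or almost
    antipodal. *)
Lemma circle_near_halve eps s t : eps <= (2 ^+ n.+1)^-1 -> same_itin s t ->
  generic s -> generic t ->
  circle_near eps (2 * s) (2 * t) -> circle_near (eps / 2) s t.
Proof.
move=> small I gs gt [m]; rewrite ltr_norml => close.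
have [h [E|E]] := int_parity m.
  by exists h; rewrite E intrM in close; rewrite ltr_norml; lra.
have : (2 ^+ n.+2)^-1 <= `|s - t - h%:~R - 2^-1| by exact: antipodal_gap.
rewrite leNgt => /negP[]; rewrite ltr_norml.
have dE : 2 ^- n.+1 = 2 * 2 ^- n.+2 :> R.
  by rewrite (exprS _ n.+1) invfM mulrA divff ?mul1r.
by rewrite dE in small; rewrite E intrD intrM in close; lra.
Qed.

Lemma circle_near_contract eps s t k : 0 < eps -> eps <= (2 ^+ n.+1)^-1 ->
  same_itin s t -> generic s ->
  generic t -> circle_near eps (2 ^+ k * s) (2 ^+ k * t) ->
    circle_near (eps / 2 ^+ k) s t.
Proof.
move=> eps0 small; elim: k s t => [|k IH] s t I gs gt;
  first by rewrite !mul1r divr1.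
rewrite !exprSr -!mulrA => H; rewrite invfM mulrA.
apply: circle_near_halve => //.
  apply: le_trans small;
    rewrite ler_pdivrMr ?exprn_gt0// ler_peMr ?(ltW eps0)//.
  by rewrite exprn_ege1// ler1n.
by apply: IH => //; [exact: same_itin_double|exact: generic_double|exact: generic_double].
Qed.

Lemma circle_near_pigeonhole N (x : nat -> R) :
  exists i j, [/\ (i < j)%N,
    (j <= N.+1)%N & circle_near N.+1%:R^-1 (x i) (x j)].
Proof.
pose fl i := Num.floor (x i * N.+1%:R).
pose cell (i : 'I_N.+2) : 'I_N.+1 := inord `|(fl i %% N.+1%:Z)%Z|%N.
have : ~~ injectiveb cell.
  apply/negP => /injectiveP inj; have := leq_card _ inj.
  by rewrite !card_ord ltnn.
rewrite /injectiveb => /dinjectivePn[i _ [j]];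
  rewrite !inE andbT => ji /(congr1 val).
have inordE (k : 'I_N.+2) : val (cell k) = `|(fl k %% N.+1%:Z)%Z|%N.
  by rewrite /= inordK//; lia.
rewrite !inordE => E.
have {E} [q qE] : exists q, fl i - fl j = q * N.+1%:Z.
  exists ((fl i %/ N.+1)%Z - (fl j %/ N.+1)%Z).
  by rewrite mulrBl; lia.
have flP k : (fl k)%:~R <= x k * N.+1%:R < (fl k)%:~R + 1.
  by have := floor_itv (x k * N.+1%:R); rewrite intrD.
have N0 : 0 < N.+1%:R :> R by rewrite ltr0n.
have close : `|x i - x j - q%:~R| < N.+1%:R^-1.
  rewrite -(ltr_pM2r N0) mulVf ?pnatr_eq0// -[X in _ * X](gtr0_norm N0) -normrM.
  have -> : (x i - x j - q%:~R) * N.+1%:R = x i * N.+1%:R - x j * N.+1%:R - (fl i - fl j)%:~R.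
    by rewrite qE intrM; ring.
  rewrite intrB ltr_norml; have := flP i; have := flP j; lra.
have [lt_ij|le_ji] := ltnP i j.
  by exists i, j; split => //; [rewrite -ltnS|exists q].
exists j, i; split; [by rewrite ltn_neqAle le_ji andbT|by rewrite -ltnS|].
exists (- q); move: close; rewrite mulrNz -normrN.
by congr (is_true (`|_| < _)); ring.
Qed.

Lemma not_circle_near s t : (forall m, s - t <> m%:~R) ->
  exists2 d, 0 < d & forall m, d <= `|s - t - m%:~R|.
Proof.
move=> nint; pose x := s - t; pose f := Num.floor x.
have /andP[fx xf] := floor_itv x; rewrite intrD -/f in fx xf.
have ne : f%:~R != x by apply/eqP => E; apply: (nint f).
have fx' : f%:~R < x by rewrite lt_neqAle ne.
exists (Num.min (x - f%:~R) (f%:~R + 1 - x)).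
  by rewrite lt_min; lra.
move=> m; rewrite -/x ge_min; have [mf|fm] := leP m f.
  have : m%:~R <= f%:~R :> R by rewrite ler_int.
  by move=> H; apply/orP; left; apply: le_trans (ler_norm _); lra.
have : f%:~R + 1 <= m%:~R :> R by rewrite -(intrD _ f 1) ler_int; lia.
by move=> H; apply/orP; right; rewrite distrC; apply: le_trans (ler_norm _);
  lra.
Qed.

(** Expansion against compactness: among N + 2 of the points, two have k-th
    images within 1 / (N + 1) and hence were themselves within 2^-k / (N + 1),
    for every k. *)
Lemma no_generic_sequence (z : nat -> R) : (forall i, generic (z i)) ->
  (forall i j, (i < j)%N -> same_itin (z i) (z j)) ->
  (forall i j, (i < j)%N -> forall m, z i - z j <> m%:~R) -> False.
Proof.
move=> gz Iz dz.
pose N := (2 ^ n.+1).-1.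
have NE : N.+1%:R = 2 ^+ n.+1 :> R by rewrite /N prednK ?expn_gt0// natrX.
have eps0 : 0 < (2 ^+ n.+1)^-1 :> R by rewrite invr_gt0 exprn_gt0.
have [|K KP] := @choice ('I_N.+2 * 'I_N.+2) nat (fun p K => (p.1 < p.2)%N ->
    forall k, (K <= k)%N ->
      ~ circle_near ((2 ^+ n.+1)^-1 / 2 ^+ k) (z p.1) (z p.2)).
  move=> [i j] /=; have [ij|] := ltnP i j; last by exists 0.
  have [d d0 dP] := not_circle_near (dz _ _ ij).
  have [K KP] := exp2_large ((2 ^+ n.+1)^-1 / d); exists K => _ k Kk [m].
  rewrite ltNge => /negP[]; apply: le_trans (dP m).
  have k0 : 0 < 2 ^+ k :> R by rewrite exprn_gt0.
  by rewrite ler_pdivrMr// mulrC -ler_pdivrMr// ltW// KP.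
pose k := \max_p K p.
have [i [j [ij jN]]] := circle_near_pigeonhole N (fun i => 2 ^+ k * z i).
rewrite NE => H.
have iN : (i < N.+2)%N by lia.
have jN' : (j < N.+2)%N by lia.
have Hk : (K (Ordinal iN, Ordinal jN') <= k)%N by exact: leq_bigmax.
apply: (KP (Ordinal iN, Ordinal jN') ij k Hk) => /=.
by apply: circle_near_contract => //; exact: Iz.
Qed.

Lemma r_iter s t k : r s t -> r (2 ^+ k * s) (2 ^+ k * t).
Proof.
move=> st; elim: k => [|k IH]; first by rewrite !mul1r.
by rewrite !exprS -!mulrA; exact: (r_double L IH).
Qed.

Lemma crit_period s k a : r (2 ^+ k * s) t0 -> r (2 ^+ (k + n * a) * s) t0.
Proof.
move=> H; elim: a => [|a IH]; first by rewrite muln0 addn0.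
rewrite mulnS addnCA exprD -mulrA; apply: (r_trans L (r_iter n IH)).
by apply: (diam_end_crit L); apply: (diam_end_iter L); exists 0; lra.
Qed.

(** Two points sharing an itinerary whose orbits meet the critical class at
    times congruent modulo n have later images that are both in that class, at
    one and the same time; by pulling back they are equivalent. So each residue
    modulo n accounts for at most one term of the sequence. *)
Lemma generic_tail (z : nat -> R) :
  (forall i j, (i < j)%N -> same_itin (z i) (z j)) ->
  (forall i j, (i < j)%N -> ~ r (z i) (z j)) ->
  exists B, forall i, (B <= i)%N -> generic (z i).
Proof.
move=> Iz dz; have [n_gt0 _] := r_period L.
have residue rho : exists B, forall i, (B <= i)%N ->
    forall a, ~ r (2 ^+ (rho + n * a) * z i) t0.
  have [[i0 [a0 H0]]|H] := pselect (exists i a,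
    r (2 ^+ (rho + n * a) * z i) t0).
    exists i0.+1 => i i0i a H; apply: (dz _ _ i0i).
    apply: (@pullback_iter _ _ _ _ L _ _ (rho + n * a0 + n * a));
      first exact: Iz.
    apply: (r_trans L (crit_period a H0)); apply: (r_sym L).
    by rewrite addnAC; exact: crit_period.
  by exists 0 => i _ a Hi; apply: H; exists i, a.
suff [B BP] : exists B, forall i, (B <= i)%N ->
    forall rho, (rho < n)%N -> forall a, ~ r (2 ^+ (rho + n * a) * z i) t0.
  exists B => i Bi k; rewrite (divn_eq k n) addnC mulnC.
  by apply: BP => //; rewrite ltn_mod.
elim: {1}n => [|l [B BP]]; first by exists 0.
have [B' B'P] := residue l; exists (maxn B B') => i Bi rho.
rewrite ltnS leq_eqVlt => /orP[/eqP->|lt_rho]; first by apply: B'P; lia.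
by apply: BP => //; lia.
Qed.

(** Inequivalent points with the same itinerary would see infinitely many
    inequivalent points with that itinerary. *)
Theorem same_itin_r s t : same_itin s t -> r s t.
Proof.
move=> Ist.
(* the lift Y of t is chosen in [s, s + 1) *)
pose m := - Num.floor (t - s); pose Y := t + m%:~R.
have /andP[fl1 fl2] := floor_itv (t - s); rewrite intrD in fl1 fl2.
apply/(r_shiftr L s m t); rewrite -/Y.
have IY : same_itin s Y by apply/same_itin_shiftr.
have sY : s <= Y < s + 1 by rewrite /Y /m mulrNz; lra.
have [->|ne] := eqVneq s Y; first exact: (r_refl L).
apply: contrapT => nsY.
have sY1 : s < Y < s + 1 by lra.
have [z [vz dz]] := visible_sequence L sY1 nsY.
have Iz i j : same_itin (z i) (z j) by exact: (visible_same_itin L sY1 IY nsY).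
have dz' i j : (i < j)%N -> ~ r (z i) (z j).
  by move=> ij /(r_sym L); exact: dz.
have [//|B BP] := generic_tail _ dz'.
apply: (@no_generic_sequence (fun i => z (B + i)%N)) => [i|i j _|i j ij m' E].
- by apply: BP; rewrite leq_addr.
- exact: Iz.
apply: (dz' (B + i)%N (B + j)%N); first by rewrite ltn_add2l.
have -> : z (B + i)%N = z (B + j)%N + m'%:~R by rewrite -E; ring.
by apply/(r_shiftl L); exact: (r_refl L).
Qed.

End Recurrence.

(** * Classes fixed by doubling *)

Section InvariantClasses.
Variables (R : realType) (t0 : R) (n : nat) (r : R -> R -> Prop).
Hypothesis L : lamination_lift t0 n r.
Implicit Types (s t u v w x y z e : R) (m q : int).
Local Notation diam_end := (diam_end t0).
Local Notation same_itin := (same_itin t0).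

Lemma invariant_noncritical a : r a (2 * a) -> ~ r a t0.
Proof.
move=> fixa H; apply: (crit_not_fixed L).
apply: (r_trans L (r_sym L (r_double L H))).
exact: (r_trans L (r_sym L fixa)).
Qed.

(** A noncritical class contains no end of the diameter and cannot cross it. *)
Lemma class_in_semicircle e a b : diam_end e -> e < a < e + 2^-1 -> r a b ->
  ~ r a t0 ->
  exists m, e < b + m%:~R < e + 2^-1.
Proof.
move=> ge ea rab na; pose m := - Num.floor (b - e).
have /andP[fl1 fl2] := floor_itv (b - e); rewrite intrD in fl1 fl2.
exists m; have : e <= b + m%:~R < e + 1 by rewrite /m mulrNz; lra.
have {rab} : r a (b + m%:~R) by apply/(r_shiftr L).
move: (b + _) => {fl1 fl2 m}b rab eb.
have ge1 : diam_end (e + 2^-1) by have := diam_end_shift 1 ge; rewrite div1r.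
have re := diam_end_crit L ge; have re1 := diam_end_crit L ge1.
have /eqP ne : b <> e by move=> E; apply: na; apply: (r_trans L rab); rewrite E.
have /eqP ne1 : b <> e + 2^-1.
  by move=> E; apply: na; apply: (r_trans L rab); rewrite E.
have [|be] := ltP b (e + 2^-1); first by lra.
case: na; apply: (r_trans L _ re); apply: (r_sym L).
apply: (@r_unlinked _ _ _ _ L e a (e + 2^-1) b) => //; try lra.
exact: (r_trans L re (r_sym L re1)).
Qed.

(** The class of 0 stays in the open semicircle from theta' to theta, whose lift
    around 0 is (t0 - 1/2, t0). Since 0 <= t0 < 1/2, no other translate of a
    doubled point of this interval falls back into it; so the orbit of a point
    other than 0 moves away from 0 along the interval until it leaves it. *)
Lemma zero_class_lift s : 0 <= t0 < 2^-1 -> r 0 s -> exists m, s = m%:~R.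
Proof.
move=> t0itv r0s.
have n0 : ~ r 0 t0 by apply: invariant_noncritical; rewrite mulr0;
  exact: r_refl L _.
have /eqP t0ne : t0 <> 0 by move=> E; apply: n0; rewrite -E; exact: r_refl L _.
have ge : diam_end (t0 - 2^-1) by exists (- 1); rewrite mulrNz; lra.
have loc b : r 0 b -> exists m, t0 - 2^-1 < b + m%:~R < t0.
  move=> r0b; have [|m Hm] := @class_in_semicircle _ 0 b ge _ r0b n0;
    first by lra.
  by exists m; lra.
have [m hm] := loc _ r0s.
have r0 k : r 0 (2 ^+ k * (s + m%:~R)).
  rewrite -[0](mulr0 (2 ^+ k)); apply: (r_iter L); exact/(r_shiftr L).
have bound k : t0 - 2^-1 < 2 ^+ k * (s + m%:~R) < t0.
  elim: k => [|k IH]; first by rewrite mul1r.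
  have [m' hm'] := loc _ (r0 k.+1); move: hm'; rewrite exprS -mulrA.
  move: (2 ^+ k * _) IH => y hy hm'.
  have m1 : - 1 < m' by rewrite -(ltr_int R) mulrNz; lra.
  have m2 : m' < 1 by rewrite -(ltr_int R); lra.
  have m0 : m' = 0 by clear - m1 m2; lia.
  by rewrite m0 addr0 in hm'.
exists (- m); rewrite mulrNz; apply/eqP; rewrite -addr_eq0;
  apply/negP => /negP ne.
have [k /(_ k (leqnn k))] := exp2_large `|s + m%:~R|^-1.
have sm0 : 0 < `|s + m%:~R| by rewrite normr_gt0.
have : `|2 ^+ k * (s + m%:~R)| < 1 by have := bound k; rewrite ltr_norml; lra.
rewrite normrM gtr0_norm ?exprn_gt0// => lt1.
by rewrite -(ltr_pM2r sm0) mulVf ?gt_eqF// => gt1; have := lt_trans gt1 lt1;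
  rewrite ltxx.
Qed.

Section Orbit.
Variable q0 : R.
Hypothesis q0_itv : t0 < q0 < t0 + 2^-1.
Hypothesis q0_inv : r q0 (2 * q0).

(** The invariant class in the open semicircle from theta to theta', lifted to
    the interval (t0, t0 + 1/2). *)
Let Q := [set s | t0 < s < t0 + 2^-1 /\ r q0 s].

Let theta_end : diam_end t0. Proof. by exists 0; lra. Qed.

Let loc b : r q0 b -> exists m, Q (b + m%:~R).
Proof.
move=> H; have [m hm] :=
  class_in_semicircle theta_end q0_itv H (invariant_noncritical q0_inv).
by exists m; split => //; apply/(r_shiftr L).
Qed.

Let r_orbit k s : r q0 s -> r q0 (2 ^+ k * s).
Proof.
move=> H; elim: k => [|k IH]; first by rewrite mul1r.
by rewrite exprS -mulrA; apply: (r_trans L q0_inv); exact: (r_double L).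
Qed.

Let Q_generic s : Q s -> generic t0 r s.
Proof.
move=> [_ H] k E; apply: (invariant_noncritical q0_inv).
exact: (r_trans L (r_orbit k H)).
Qed.

Let Q_same_itin s t : Q s -> Q t -> same_itin s t.
Proof.
move=> [_ /r_orbit Hs] [_ /r_orbit Ht] k.
have [m1 [b1 _]] := loc (Hs k); have [m2 [b2 _]] := loc (Ht k).
apply/(same_side_shiftr t0 _ _ m2)/(same_side_shiftl t0 _ _ m1).
by exists t0, 0; split; rewrite ?addr0 //; lra.
Qed.

(** Q is finite, in the form in which it is used: it contains no strictly
    monotone sequence, because its points are generic and have the same
    itinerary. *)
Let Q_no_sequence (z : nat -> R) : (forall i, Q (z i)) ->
  (forall i, z i.+1 < z i) \/ (forall i, z i < z i.+1) -> False.
Proof.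
move=> Qz mono; apply: (@no_generic_sequence _ _ _ _ L z) =>
  [i|i j _|i j ij m E].
- exact: Q_generic.
- exact: Q_same_itin.
have ne : z i != z j.
  case: mono => mono.
    have : z j < z i.
      elim: j ij {E} => // j IH; rewrite ltnS leq_eqVlt => /orP[/eqP->//|/IH].
      exact: lt_trans.
    by move/lt_eqF; rewrite eq_sym => ->.
  have : z i < z j.
    elim: j ij {E} => // j IH; rewrite ltnS leq_eqVlt => /orP[/eqP->//|/IH H].
    exact: lt_trans (mono j).
  by move/lt_eqF => ->.
have [] := Qz i; have [] := Qz j => bj _ bi _.
have m0 : m = 0 by apply: (@int_eq0_lt1 R); lra.
by move: ne; rewrite -subr_eq0 E m0 eqxx.
Qed.

Let Q_max : exists2 M, Q M & forall s, Q s -> s <= M.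
Proof.
have [//|no] := pselect (exists2 M, Q M & forall s, Q s -> s <= M).
have [||z zP] := @iterated_choice R Q (fun x y => x < y).
- by exists q0; split => //; exact: r_refl L _.
- move=> x Qx; apply: contrapT => H; apply: no; exists x => // s Qs.
  by rewrite leNgt; apply/negP => xs; apply: H; exists s.
by case: (@Q_no_sequence z) => [i|]; [have [] := zP i|right=> i;
  have [] := zP i].
Qed.

Let Q_next s M : Q s -> Q M -> s < M ->
  exists y, [/\ Q y, s < y & forall w, Q w -> s < w -> y <= w].
Proof.
move=> Qs QM sM; apply: contrapT => no.
have [||z zP] := @iterated_choice R [set w | Q w /\ s < w] (fun x y => y < x).
- by exists M.
- move=> x [Qx sx]; apply: contrapT => H; apply: no; exists x;
    split => // w Qw sw.
  by rewrite leNgt; apply/negP => wx; apply: H; exists w.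
by case: (@Q_no_sequence z) => [i|]; [have [[]] := zP i|left=> i;
  have [] := zP i].
Qed.

Let Q_surj w : Q w -> exists2 v, Q v & exists m, 2 * v = w + m%:~R.
Proof.
move=> [wb Hw].
have [H|H] : r q0 (w / 2) \/ r q0 (w / 2 + 2^-1).
- apply: (r_half L); have -> : 2 * (w / 2) = w by lra.
  by apply: (r_trans L (r_sym L q0_inv)).
- have [m Qm] := loc H; exists (w / 2 + m%:~R) => //.
  by exists (2 * m); rewrite intrM; lra.
have [m Qm] := loc H; exists (w / 2 + 2^-1 + m%:~R) => //.
by exists (2 * m + 1); rewrite intrD intrM; lra.
Qed.

(** The gap between a point x of Q and the next point is mapped to a gap twice
    as long, unless x is the rightmost point M; so the orbit of s must meet M,
    as gaps have length less than 1/2. *)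
Let Q_reaches_max M s : Q M -> (forall w, Q w -> w <= M) -> Q s ->
  exists k m, 2 ^+ k * s = M + m%:~R.
Proof.
move=> QM maxM Qs; apply: contrapT => no.
have neM k x m : 2 ^+ k * s = x + m%:~R -> Q x -> x < M.
  move=> E Qx; rewrite lt_neqAle maxM// andbT; apply/eqP => xM.
  by apply: no; exists k, m; rewrite -xM.
have [|y0 [Qy0 sy0 next0]] := @Q_next s M Qs QM.
  by apply: (neM 0 s 0) => //; rewrite mul1r addr0.
have gaps k : exists x y m, [/\ Q x, Q y, 2 ^+ k * s = x + m%:~R,
    y - x = 2 ^+ k * (y0 - s) & forall w, Q w -> ~ (x < w < y)].
  elim: k => [|k [x [y [m [Qx Qy E width gap]]]]].
    exists s, y0, 0; split => //; rewrite ?mul1r ?addr0// => w Qw.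
    by move=> /andP[sw wy]; have := next0 _ Qw sw; lra.
  have [i Qx'] : exists i, Q (2 * x + i%:~R).
    apply: loc; apply: (r_trans L q0_inv); apply: (r_double L); by case: Qx.
  (* a point of Q in the doubled gap is the double of a point of Q, which lies
   in the gap itself since its antipode is outside the semicircle *)
  have gap' w : Q w -> ~ (2 * x + i%:~R < w < 2 * y + i%:~R).
    move=> Qw hw; have [v Qv [j vE]] := Q_surj Qw.
    have [bx _] := Qx; have [hy _] := Qy; have [bv _] := Qv.
    have [c [hE|hE]] := int_parity (j + i).
      have cE : j%:~R + i%:~R = c%:~R * 2 :> R by rewrite -intrD hE intrM.
      have c0 : c = 0 by apply: (@int_eq0_lt1 R); lra.
      by rewrite c0 mul0r in cE; apply: (gap _ Qv); lra.
    have cE : j%:~R + i%:~R = c%:~R * 2 + 1 :> R.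
      by rewrite -intrD hE intrD intrM.
    have c1 : - 1 < c by rewrite -(ltr_int R) mulrNz; lra.
    have c2 : c < 0 by rewrite -(ltr_int R) mulr0z; lra.
    by clear - c1 c2; lia.
  have E' : 2 ^+ k.+1 * s = 2 * x + i%:~R + (2 * m - i)%:~R.
    by rewrite exprS -mulrA E intrB intrM; ring.
  have xM := neM _ _ _ E' Qx'.
  have yM : 2 * y + i%:~R <= M.
    by rewrite leNgt; apply/negP => yM; apply: (gap' _ QM); rewrite xM.
  exists (2 * x + i%:~R), (2 * y + i%:~R), (2 * m - i); split => //.
  - have [bM _] := QM; have [bx' _] := Qx'; have [_ ry] := Qy.
    have sy : 0 < 2 ^+ k * (y0 - s) by rewrite mulr_gt0 ?exprn_gt0//; lra.
    split; first by lra.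
    by apply/(r_shiftr L); apply: (r_trans L q0_inv); exact: (r_double L).
  - by rewrite exprS -mulrA -width; ring.
have [k /(_ k (leqnn k)) big] := exp2_large (y0 - s)^-1.
have [x [y [m [[bx _] [hy _] _ width _]]]] := gaps k.
have d0 : 0 < y0 - s by lra.
move: big; rewrite -(ltr_pM2r d0) mulVf ?gt_eqF// -width; lra.
Qed.

Let Q_cancel k s t m : Q s -> Q t -> 2 ^+ k * s = 2 ^+ k * t + m%:~R -> s = t.
Proof.
elim: k s t m => [|k IH] s t m Qs Qt.
  rewrite !mul1r => E; have [[bs _] [bt _]] := (Qs, Qt).
  have m0 : m = 0 by apply: (@int_eq0_lt1 R); lra.
  by rewrite E m0 addr0.
have step x : Q x -> exists i, Q (2 * x + i%:~R).
  by move=> [_ rx]; apply: loc; apply: (r_trans L q0_inv); exact: (r_double L).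
have [[i Qi] [j Qj]] := (step _ Qs, step _ Qt).
rewrite exprSr -!mulrA => E.
have : 2 * s + i%:~R = 2 * t + j%:~R.
  apply: (IH _ _ (m + 2 ^+ k * i - 2 ^+ k * j)) => //.
  by rewrite !mulrDr E intrB intrD !intrM !rmorphXn /=; ring.
have [[bs _] [bt _]] := (Qs, Qt) => E2.
have m0 : i - j = 0 by apply: (@int_eq0_lt1 R); rewrite intrB; lra.
have ij : i = j by clear - m0; lia.
by rewrite ij in E2; lra.
Qed.

(** Q is the orbit of its rightmost point M: every orbit in Q reaches M, so M is
    periodic, and doubling is injective on Q. *)
Lemma invariant_class_cyclic : exists M,
  [/\ t0 < M < t0 + 2^-1, r q0 M,
      exists k m, 2 ^+ k.+1 * M = M + m%:~R,
      forall s, r q0 s -> exists k m, 2 ^+ k * s = M + m%:~R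
    & forall s, r q0 s -> exists j m, s = 2 ^+ j * M + m%:~R].
Proof.
have [M QM maxM] := Q_max; exists M.
have reach s : r q0 s -> exists k m, 2 ^+ k * s = M + m%:~R.
  move=> /loc[i Qi]; have [k [m E]] := Q_reaches_max QM maxM Qi.
  exists k, (m - 2 ^+ k * i); move: E; rewrite mulrDr intrB intrM rmorphXn /=.
  by move=> E; rewrite addrA -E; ring.
have [bM rM] := QM.
have [k0 [m0 E0]] : exists k m, 2 ^+ k.+1 * M = M + m%:~R.
  have [k [m E]] := reach _ (r_orbit 1 rM).
  by exists k, m; rewrite exprSr -mulrA.
split => //; first by exists k0, m0.
move=> s rs; have [k [m E]] := reach _ rs; have [i Qi] := loc rs.
have per a : exists m', 2 ^+ (a * k0.+1) * M = M + m'%:~R.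
  elim: a => [|a [m' IH]]; first by exists 0; rewrite mul1r addr0.
  exists (m0 + 2 ^+ k0.+1 * m').
  by rewrite mulSn exprD -mulrA IH mulrDr E0 intrD intrM rmorphXn /= addrA.
have [m' Ek] := per k.
have [j Qj] := loc (r_orbit (k * k0) rM).
exists (k * k0)%N, (j - i).
suff H : s + i%:~R = 2 ^+ (k * k0) * M + j%:~R by rewrite intrB addrA -H; ring.
apply: (@Q_cancel k _ _ (m - m' + 2 ^+ k * i - 2 ^+ k * j)) => //.
rewrite mulrDr E mulrDr mulrA -exprD -mulnS Ek.
by rewrite intrB intrD intrB !intrM rmorphXn /=; ring.
Qed.

End Orbit.
End InvariantClasses.

(** * Coordinates on the circle and crossing chords *)

Section Circle.
Variable R : realType.
Local Notation T := (circle R).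
Implicit Types (s t u v : R) (m : int).

Lemma ang_surj (x : T) : exists s : R, x = ang s.
Proof. by exists (repr x); rewrite /ang reprK. Qed.

Lemma angP s t : ang s = ang t <-> exists m, s = t + m%:~R.
Proof.
rewrite ang_eq; split=> [/intrP[m E]|[m ->]]; first by exists m; rewrite -E;
  ring.
by rewrite addrAC subrr add0r; apply/intrP; exists m.
Qed.

Lemma ang_int s m : ang (s + m%:~R) = ang s.
Proof. by apply/angP; exists m. Qed.

Lemma ang0 : ang 0 = 0 :> T.
Proof. by apply: (@addrI _ (ang 0)); rewrite -angD !addr0. Qed.

Lemma sigma_ang s : sigma (ang s) = ang (2 * s).
Proof. by rewrite /sigma mulr2n -angD; congr ang; ring. Qed.

Lemma iter_sigma k s : iter k (@sigma R) (ang s) = ang (2 ^+ k * s).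
Proof.
elim: k => [|k IH] /=; first by rewrite mul1r.
by rewrite IH sigma_ang mulrA exprS.
Qed.

Lemma antipode_ang s : antipode (ang s) = ang (s + 2^-1).
Proof. by rewrite angD. Qed.

Lemma ang_continuous : continuous (@ang R).
Proof. exact: pi_continuous. Qed.

(** On the circle, the parameter of a half turn is determined, since parameters
    of arcs are less than 1. *)
Lemma half_arc_lift s x : circle_arc (ang s) (ang (s + 2^-1)) x ->
  exists w, x = ang w /\ s <= w <= s + 2^-1.
Proof.
case=> a [u [a0 au u1 xE]]; rewrite -angD => /angP[m E].
have m1 : m < 1 by rewrite -(ltr_int R); lra.
have m2 : -1 < m by rewrite -(ltr_int R) mulrNz; lra.
have m0 : m = 0 by clear - m1 m2; lia.
rewrite m0 in E; exists (s + a); rewrite angD; split => //; lra.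
Qed.

Definition unit_pt s : R^o * R^o := (cos (2 * pi * s), sin (2 * pi * s)).

Lemma unit_pt_int s m : unit_pt (s + m%:~R) = unit_pt s.
Proof.
have pt_nat u k : unit_pt (u + k%:R) = unit_pt u.
  have E : 2 * pi * (u + k%:R) = 2 * pi * u + pi *+ 2 *+ k.
    by rewrite -[_ *+ k]mulr_natr; ring.
  by rewrite /unit_pt E (periodicn (@cosD2pi R)) (periodicn (@sinD2pi R)).
case: m => k; first exact: pt_nat.
by rewrite NegzE mulrNz -[in RHS](subrK k.+1%:R s) pt_nat.
Qed.

Lemma circle_pt_ang s : circle_pt (ang s) = unit_pt s.
Proof.
have [m E] : exists m, repr (ang s) = s + m%:~R :> R.
  by apply/angP; rewrite /ang reprK.
by rewrite -(unit_pt_int s m) -E.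
Qed.

Lemma convex_hull_segment (A : set (R^o * R^o)) p q (l : R) :
  A p -> A q -> 0 <= l <= 1 -> convex_hull A (l *: p + (1 - l) *: q).
Proof.
move=> Ap Aq /andP[l0 l1] M [Mconv AM].
have := Mconv p q (Itv01 l0 l1) (mem_set (AM _ Ap)) (mem_set (AM _ Aq)).
by move/set_mem.
Qed.

Lemma convex_hull_sub (A B : set (R^o * R^o)) : A `<=` B ->
  convex_hull A `<=` convex_hull B.
Proof. by move=> AB p Hp M [Mconv BM]; apply: Hp; split => //;
  exact: subset_trans BM. Qed.


Lemma sin_half_turn s t : s < t < s + 1 -> 0 < sin (pi * (t - s)) :> R.
Proof.
move=> st; apply: sin_gt0_pi; rewrite mulr_gt0 ?pi_gt0//=; last by lra.
by rewrite -[ltRHS]mulr1 ltr_pM2l ?pi_gt0//; lra.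
Qed.

(** Twice the signed area of the triangle with vertices p, q and w. *)
Definition area (p q w : R^o * R^o) : R :=
  (q.1 - p.1) * (w.2 - p.2) - (q.2 - p.2) * (w.1 - p.1).

(** With x and y the half-angles subtending the first two sides, this is sin 2x
    + sin 2y - sin (2x + 2y) = 4 sin x sin y sin (x + y). *)
Lemma area_gt0 s t u : s < t -> t < u -> u < s + 1 ->
  0 < area (unit_pt s) (unit_pt t) (unit_pt u).
Proof.
move=> st tu us.
have -> : area (unit_pt s) (unit_pt t) (unit_pt u) =
    4 * sin (pi * (t - s)) * sin (pi * (u - t)) * sin (pi * (u - s)).
  rewrite /area /unit_pt /=.
  pose x := pi * (t - s); pose y := pi * (u - t).
  have dbl w : sin (w + w) = 2 * sin w * cos w :> R by rewrite sinD; ring.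
  have cdbl w : cos (w + w) = 1 - 2 * sin w ^+ 2 :> R.
    by rewrite cosD -!expr2 cos2sin2; ring.
  have E1 : sin (2 * pi * t - 2 * pi * s) = 2 * sin x * cos x.
    by rewrite -dbl; congr sin; rewrite /x; ring.
  have E2 : sin (2 * pi * u - 2 * pi * t) = 2 * sin y * cos y.
    by rewrite -dbl; congr sin; rewrite /y; ring.
  have E3 : sin (2 * pi * u - 2 * pi * s) =
      2 * sin x * cos x * (1 - 2 * sin y ^+ 2) +
      (1 - 2 * sin x ^+ 2) * (2 * sin y * cos y).
    by rewrite -!dbl -!cdbl -sinD; congr sin; rewrite /x /y; ring.
  have -> : sin (pi * (u - s)) = sin x * cos y + cos x * sin y.
    by rewrite -sinD; congr sin; rewrite /x /y; ring.
  rewrite -/x -/y; rewrite !sinB in E1 E2 E3; nra.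
by rewrite !mulr_gt0// sin_half_turn//; lra.
Qed.

(** The affine relation between the four points, whose coefficients are the
    areas of the triangles that they form, exhibits a common point of the two
    diagonals. Being a proper convex combination of two distinct unit vectors,
    it lies inside the open disk. *)
Lemma chords_meet s u t v : s < u -> u < t -> t < v -> v < s + 1 -> exists p,
  [/\ chord (ang s, ang t) p, chord (ang u, ang v) p & open_disk p].
Proof.
move=> su ut tv vs.
have al : 0 < area (unit_pt u) (unit_pt t) (unit_pt v) by apply: area_gt0; lra.
have be : 0 < area (unit_pt s) (unit_pt t) (unit_pt v) by apply: area_gt0; lra.
have ga : 0 < area (unit_pt s) (unit_pt u) (unit_pt v) by apply: area_gt0; lra.
have de : 0 < area (unit_pt s) (unit_pt u) (unit_pt t) by apply: area_gt0; lra.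
have circ w : (unit_pt w).1 ^+ 2 + (unit_pt w).2 ^+ 2 = 1 by exact: cos2Dsin2.
have in_chord w1 w2 l : 0 <= l <= 1 ->
    chord (ang w1, ang w2) (l *: unit_pt w1 + (1 - l) *: unit_pt w2).
  move=> l01; apply: convex_hull_segment => //; rewrite -circle_pt_ang;
    apply: imageP => /=; by [left|right].
move: (circ s) (circ t) (in_chord s t) (in_chord u v) al be ga de.
move: (unit_pt s) (unit_pt u) (unit_pt t) (unit_pt v) =>
  A B C D cA cC chordAC chordBD.
have sumE : area B C D + area A B D = area A C D + area A B C.
  by rewrite /area; ring.
have combE1 : area B C D * A.1 + area A B D * C.1 =
    area A C D * B.1 + area A B C * D.1.
  by rewrite /area; ring.
have combE2 : area B C D * A.2 + area A B D * C.2 =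
    area A C D * B.2 + area A B C * D.2.
  by rewrite /area; ring.
have sep : 0 < area A B C -> 0 < (A.1 - C.1) ^+ 2 + (A.2 - C.2) ^+ 2.
  move=> pos; rewrite lt_neqAle addr_ge0 ?sqr_ge0// andbT eq_sym.
  apply: contraTneq pos => /eqP;
    rewrite paddr_eq0 ?sqr_ge0// !sqrf_eq0 !subr_eq0.
  by move=> /andP[/eqP e1 /eqP e2];
    rewrite /area e1 e2 !subrr !mulr0 subrr ltxx.
move: (area B C D) (area A C D) (area A B D) (area A B C) sumE combE1 combE2 sep.
move=> al be ga de sumE combE1 combE2 sep al0 be0 ga0 de0;
  have {sep} dist := sep de0.
have S0 : 0 < al + ga by lra.
pose l := al / (al + ga); pose l' := be / (al + ga).
have lE : l * (al + ga) = al by rewrite divfK ?gt_eqF.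
have l'E : l' * (al + ga) = be by rewrite divfK ?gt_eqF.
have l0 : 0 < l by rewrite divr_gt0.
have l1 : l < 1 by rewrite ltr_pdivrMr//; lra.
have l'0 : 0 < l' by rewrite divr_gt0.
have l'1 : l' < 1 by rewrite ltr_pdivrMr//; lra.
have PE : l *: A + (1 - l) *: C = l' *: B + (1 - l') *: D.
  apply: (@scalerI R _ (al + ga)); first by rewrite gt_eqF.
  rewrite !scalerDr !scalerA.
  have -> : (al + ga) * l = al by rewrite mulrC.
  have -> : (al + ga) * l' = be by rewrite mulrC.
  have -> : (al + ga) * (1 - l) = ga by rewrite mulrBr mulr1 mulrC lE; ring.
  have -> : (al + ga) * (1 - l') = de by rewrite mulrBr mulr1 mulrC l'E; lra.
  case: A B C D {cA cC chordAC chordBD dist} combE1 combE2 => [a1 a2] [b1 b2]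
    [c1 c2] [d1 d2] /= e1 e2.
  by rewrite /GRing.scale /= /GRing.add /=; congr (_, _).
exists (l *: A + (1 - l) *: C); split.
- by apply: chordAC; rewrite (ltW l0) (ltW l1).
- by rewrite PE; apply: chordBD; rewrite (ltW l'0) (ltW l'1).
rewrite /open_disk /=.
case: A C cA cC dist {chordAC chordBD PE combE1 combE2 B D} => [a1 a2] [c1 c2]
  /= cA cC dist.
have -> : (l * a1 + (1 - l) * c1) ^+ 2 + (l * a2 + (1 - l) * c2) ^+ 2 =
    l * (a1 ^+ 2 + a2 ^+ 2) + (1 - l) * (c1 ^+ 2 + c2 ^+ 2)
    - l * (1 - l) * ((a1 - c1) ^+ 2 + (a2 - c2) ^+ 2) by ring.
have : 0 < l * (1 - l) * ((a1 - c1) ^+ 2 + (a2 - c2) ^+ 2).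
  by rewrite mulr_gt0// mulr_gt0//; lra.
by rewrite cA cC; lra.
Qed.

End Circle.

(** * From the circle to the line and back *)

Section CircleLamination.
Variables (R : realType) (t0 : R).
Hypothesis hper : periodic_pt (@sigma R) (sigma (ang t0)).
Variable sim : circle R -> circle R -> Prop.
Hypothesis lam : is_lamination sim.
Hypothesis inv : sigma_invariant sim.
Hypothesis nondeg : ~ degenerate_lam sim.
Hypothesis sim0 : sim (ang t0) (antipode (ang t0)).

Let r (s t : R) := sim (ang s) (ang t).

Let sim_refl x : sim x x. Proof. by case: lam => -[]. Qed.
Let sim_sym x y : sim x y -> sim y x. Proof. by case: lam => -[_ + _] _ _ _;
  apply. Qed.
Let sim_trans x y z : sim x y -> sim y z -> sim x z.
Proof. by case: lam => -[_ _ +] _ _ _; apply. Qed.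

Let sigma_class x y : sim (sigma x) y <-> exists2 w, sim x w & sigma w = y.
Proof.
have [a E] := inv (ex_intro _ x erefl : is_class sim [set w | sim x w]).
have ax : sim a (sigma x).
  have : (@sigma R @` [set w | sim x w]) (sigma x) by exists x => //=;
    exact: sim_refl.
  by rewrite E.
split=> [H|[w xw <-]].
  suff : (@sigma R @` [set w | sim x w]) y by case=> w; exists w.
  by rewrite E /=; exact: sim_trans ax H.
apply: sim_trans (sim_sym ax) _.
have : (@sigma R @` [set w | sim x w]) (sigma w) by exists w.
by rewrite E.
Qed.

Lemma lifted_closed : closed [set p : R * R | r p.1 p.2].
Proof.
have [_ clo _ _] := lam.
pose f (p : R * R) : circle R * circle R := (ang p.1, ang p.2).
have fc : continuous f.
  move=> p; apply: (@cvg_pair _ _ _ _ (nbhs (ang p.1)) (nbhs (ang p.2)) _ _ _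
    (fun q : R * R => ang q.1) (fun q => ang q.2)).
    by apply: (@cvg_comp _ _ _ fst ang); [exact: cvg_fst|exact: ang_continuous].
  by apply: (@cvg_comp _ _ _ snd ang); [exact: cvg_snd|exact: ang_continuous].
by apply: (@preimage_closed _ _ f) clo => p _; exact: fc.
Qed.

Lemma lifted_unlinked (s u t v : R) : s < u -> u < t -> t < v -> v < s + 1 ->
  r s t -> r u v -> r s u.
Proof.
move=> su ut tv vs st uv; have [_ _ _ unl] := lam.
apply: contrapT => nsu.
have [p [hp1 hp2 _]] := chords_meet su ut tv vs.
have ne : [set y | sim (ang s) y] <> [set y | sim (ang u) y].
  by move=> E; apply: nsu; rewrite /r -/([set y | sim (ang s) y] (ang u)) E;
    exact: sim_refl.
have := unl _ _ (ex_intro _ _ erefl) (ex_intro _ _ erefl) ne.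
apply/eqP/set0P; exists p; split.
  apply: convex_hull_sub hp1; apply: image_subset => y [->|->] //=;
    exact: sim_refl.
apply: convex_hull_sub hp2; apply: image_subset => y [->|->] //=;
  exact: sim_refl.
Qed.

Lemma lamination_lift_exists : exists n, lamination_lift t0 n r.
Proof.
have [n n_gt0] := hper; rewrite sigma_ang iter_sigma => /angP[m0 E0].
have r_intr s m : r s (s + m%:~R) by rewrite /r ang_int; exact: sim_refl.
exists n; split.
- by move=> s; exact: sim_refl.
- by move=> s t; exact: sim_sym.
- by move=> s t u; exact: sim_trans.
- exact: r_intr.
- exact: lifted_closed.
- exact: lifted_unlinked.
- by move=> s t st; rewrite /r -!sigma_ang; apply/sigma_class; exists (ang t).
- move=> s t; rewrite /r -!sigma_ang => /sigma_class[w sw].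
  have [w' wE] := ang_surj w; rewrite {w}wE in sw *.
  rewrite !sigma_ang => /angP[m E]; have [h [hE|hE]] := int_parity m.
    left; apply: sim_trans sw _.
    have -> : w' = t + h%:~R by rewrite hE intrM in E; lra.
    by apply: sim_sym; exact: r_intr.
  right; apply: sim_trans sw _.
  have -> : w' = t + 2^-1 + h%:~R by rewrite hE intrD intrM in E; lra.
  by apply: sim_sym; exact: r_intr.
- by rewrite /r -antipode_ang.
- apply: contrapT => H; apply: nondeg => x y.
  have [s ->] := ang_surj x; have [t ->] := ang_surj y.
  have r0 w : r w t0 by apply: contrapT => nw; apply: H; exists w.
  by apply: sim_trans (r0 s) _; apply: sim_sym; exact: r0.
by split => //; exists m0.
Qed.

Lemma arcs_same_side (s t : R) :
  (circle_arc (ang t0) (antipode (ang t0)) (ang s) /\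
   circle_arc (ang t0) (antipode (ang t0)) (ang t)) \/
  (circle_arc (antipode (ang t0)) (ang t0) (ang s) /\
   circle_arc (antipode (ang t0)) (ang t0) (ang t)) -> same_side t0 s t.
Proof.
have key e b : diam_end t0 e -> b = ang (e + 2^-1) ->
    circle_arc (ang e) b (ang s) /\ circle_arc (ang e) b (ang t) ->
      same_side t0 s t.
  move=> ge -> [/half_arc_lift[w [/angP[m1 ->] hw]]
    /half_arc_lift[w' [/angP[m2 ->] hw']]].
  apply/(same_side_shiftl t0)/(same_side_shiftr t0).
  by exists e, 0; rewrite addr0.
rewrite antipode_ang => -[]; apply: key => //.
- by exists 0; lra.
- by exists 1; lra.
by apply/angP; exists (- 1); rewrite mulrNz; lra.
Qed.

Lemma same_itinerary_sim (x y : circle R) :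
  (forall k : nat,
     (circle_arc (ang t0) (antipode (ang t0)) (iter k (@sigma R) x) /\
      circle_arc (ang t0) (antipode (ang t0)) (iter k (@sigma R) y)) \/
     (circle_arc (antipode (ang t0)) (ang t0) (iter k (@sigma R) x) /\
      circle_arc (antipode (ang t0)) (ang t0) (iter k (@sigma R) y))) ->
  sim x y.
Proof.
have [s ->] := ang_surj x; have [t ->] := ang_surj y => H.
have [n L] := lamination_lift_exists.
apply: (same_itin_r L) => k; apply: arcs_same_side.
by have := H k; rewrite !iter_sigma.
Qed.

(** Both orders of the ends are needed: a leaf is encoded by either of two
    pairs. *)
Lemma cross_diameter (s t : R) : t0 < s -> s < t0 + 2^-1 -> t0 + 2^-1 < t ->
  t < t0 + 1 ->
  cross (ang s, ang t) (ang t0, antipode (ang t0)) /\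
  cross (ang t, ang s) (ang t0, antipode (ang t0)).
Proof.
move=> h1 h2 h3 h4; rewrite antipode_ang.
have far w : t0 < w < t0 + 1 -> ang t0 <> ang w.
  move=> hw /angP[m E].
  have m1 : m < 0 by rewrite -(ltr_int R) mulr0z; lra.
  have m2 : - 1 < m by rewrite -(ltr_int R) mulrNz; lra.
  by clear - m1 m2; lia.
have fs : ang t0 <> ang s by apply: far; lra.
have ft : ang t0 <> ang t by apply: far; lra.
have [p [p1 p2 p3]] := chords_meet h1 h2 h3 h4.
split; split.
- by case=> [[/fs]|[/ft]].
- by exists p; split => //; split.
- by case=> [[/ft]|[/fs]].
by exists p; split => //; split => //; rewrite /chord /= setUC.
Qed.

Lemma uncrossed_same_side (s t : R) :
  ~ cross (ang s, ang t) (ang t0, antipode (ang t0)) -> same_side t0 s t.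
Proof.
have norm w : exists m, t0 <= w + m%:~R < t0 + 1.
  exists (- Num.floor (w - t0)); have := floor_itv (w - t0).
  by rewrite intrD mulrNz; lra.
have [m1 hs] := norm s; have [m2 ht] := norm t => nx.
apply/(same_side_shiftl t0 _ _ m1)/(same_side_shiftr t0 _ _ m2).
rewrite -(ang_int s m1) -(ang_int t m2) in nx.
move: (s + _) (t + _) hs ht nx => {m1 m2} {}s {}t hs ht nx.
have g0 : diam_end t0 t0 by exists 0; lra.
have g1 : diam_end t0 (t0 + 2^-1) by exists 1; lra.
have g2 : diam_end t0 (t0 - 2^-1) by exists (- 1); rewrite mulrNz; lra.
have [sl|sr] := leP s (t0 + 2^-1); have [tl|tr] := leP t (t0 + 2^-1).
- by apply: (sectors_same_side g0); left; lra.
- have [E|ne] := eqVneq t0 s.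
    by apply: (sectors_same_side g2); [left|right]; lra.
  have [E|ne'] := eqVneq s (t0 + 2^-1).
    by apply: (sectors_same_side g1); left; lra.
  by case: nx; apply: (@cross_diameter s t _ _ _ _).1; lra.
- have [E|ne] := eqVneq t0 t.
    by apply: (sectors_same_side g2); [right|left]; lra.
  have [E|ne'] := eqVneq t (t0 + 2^-1).
    by apply: (sectors_same_side g1); left; lra.
  by case: nx; apply: (@cross_diameter t s _ _ _ _).2; lra.
by apply: (sectors_same_side g1); left; lra.
Qed.

Lemma geolam_diameter n : geolam (ang t0) n (ang t0, antipode (ang t0)).
Proof. by elim: n => [|n IH]; left. Qed.

(** A leaf added at stage n + 1 does not cross the diameter, so its ends are in
    one closed semicircle and [pullback] applies. *)
Lemma geolam_sim n a b : geolam (ang t0) n (a, b) -> sim a b.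
Proof.
have [p L] := lamination_lift_exists.
elim: n a b => [|n IH] a b /=.
  by case=> -[-> ->] //; exact: sim_sym.
case=> [/IH//|[/IH]] /=.
have [s ->] := ang_surj a; have [t ->] := ang_surj b;
  rewrite !sigma_ang => st nx.
apply: (pullback L) st; apply: uncrossed_same_side; apply: nx;
  exact: geolam_diameter.
Qed.

Lemma geolam_infty_sim a b : geolam_infty (ang t0) (a, b) -> sim a b.
Proof.
have [_ clo _ _] := lam => H.
suff : closure [set p : circle R * circle R | sim p.1 p.2] (a, b).
  by rewrite -((closure_id _).1 clo).
apply: closure_subset H => -[x y] [n _]; exact: geolam_sim.
Qed.

Hypothesis t0_itv : 0 <= t0 < 2^-1.

Lemma zero_class_trivial y : sim 0 y -> y = 0.
Proof.
have [n L] := lamination_lift_exists; have [s ->] := ang_surj y.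
rewrite -ang0 => /(zero_class_lift L t0_itv)[m ->]; apply/angP; exists m; lra.
Qed.

Section RotationalSet.
Variable A : set (circle R).
Hypothesis A_rot : is_A (ang t0) A.

Let A_sigma : @sigma R @` A = A.
Proof. by case: A_rot => -[rho []]. Qed.

Let A_nonempty : A !=set0.
Proof.
case: A_rot => -[rho [_ _ _ [[[x _ ->] _]|[_ [h [_ _ hA _]]]]]] _ _.
  by exists x, 0.
have [x Ax _] : (h @` A) 0 by rewrite hA.
by exists x.
Qed.

Let A_iter k x : A x -> A (iter k (@sigma R) x).
Proof. by move=> Ax; elim: k => //= k IH; rewrite -A_sigma;
  exists (iter k (@sigma R) x). Qed.

Let A_sim x y : A x -> A y -> sim x y.
Proof.
move=> Ax Ay; have [_ sub _] := A_rot.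
by apply: same_itinerary_sim => k; left; split; apply: sub; exact: A_iter.
Qed.

(** All points of A have the itinerary that never leaves the first semicircle,
    so they lie in one class; that class contains the images of its points and
    is therefore a single orbit, which A exhausts since sigma(A) = A. *)
Lemma rotational_class : [/\ periodic_orbit (@sigma R) A, is_class sim A,
  @sigma R @` A = A
  & forall x, A x -> ~ sim x (ang t0)].
Proof.
have [n L] := lamination_lift_exists; have [a Aa] := A_nonempty;
  have [_ sub _] := A_rot.
rewrite antipode_ang in sub; have [q [aE q_itv]] := half_arc_lift (sub _ Aa);
  subst a.
have q_inv : r q (2 * q).
  by rewrite /r -sigma_ang; apply: A_sim => //; exact: (A_iter 1).
have nq := invariant_noncritical L q_inv.
have {}q_itv : t0 < q < t0 + 2^-1.
  have /eqP h1 : q <> t0 by move=> E; apply: nq; rewrite E; exact: sim_refl.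
  have /eqP h2 : q <> t0 + 2^-1.
    by move=> E; apply: nq; rewrite E; apply: sim_sym; rewrite /r -antipode_ang.
  by lra.
have [M [_ rM [k0 [m0 E0]] reach orb]] := invariant_class_cyclic L q_itv q_inv.
have AM : A (ang M).
  have [k [m E]] := reach _ (sim_refl (ang q)).
  by rewrite -(ang_int M m) -E -iter_sigma; exact: A_iter.
have in_orbit x : sim (ang q) x -> orbit_set (@sigma R) (ang M) x.
  have [s ->] := ang_surj x => /orb[j [m ->]].
  by rewrite ang_int -iter_sigma; exists j.
have orbitA : orbit_set (@sigma R) (ang M) `<=` A by move=> _ [k _ <-];
  exact: A_iter.
split => //.
- exists (ang M); first by exists k0.+1 => //; rewrite iter_sigma E0 ang_int.
  by apply/seteqP; split => // x Ax; apply: in_orbit; exact: A_sim.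
- exists (ang q); apply/seteqP; split=> [x Ax|x /in_orbit/orbitA //].
  exact: A_sim.
by move=> x Ax xt; apply: nq; apply: sim_trans xt; exact: A_sim.
Qed.

End RotationalSet.
End CircleLamination.

Theorem theorem6p2 (R : realType) (t : R) (ht : 0 <= t < 2^-1)
    (hper : periodic_pt (@sigma R) (sigma (ang t))) :
  let theta := ang t in
  let theta' := antipode theta in
  (forall sim : circle R -> circle R -> Prop,
     is_lamination sim -> sigma_invariant sim -> ~ degenerate_lam sim ->
     sim theta theta' ->
     [/\ forall alpha beta : circle R,
           (forall k : nat,
              (circle_arc theta theta' (iter k (@sigma R) alpha) /\
               circle_arc theta theta' (iter k (@sigma R) beta)) \/
              (circle_arc theta' theta (iter k (@sigma R) alpha) /\
               circle_arc theta' theta (iter k (@sigma R) beta))) ->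
           sim alpha beta,
         forall a b : circle R, geolam_infty theta (a, b) -> sim a b
       & [/\ is_class sim [set 0],
             @sigma R @` [set 0] = [set 0]
           & forall A : set (circle R), is_A theta A ->
               [/\ periodic_orbit (@sigma R) A, is_class sim A,
                   @sigma R @` A = A & A <> [set 0] ] ] ]) /\
  (basic_rotational theta ->
   ~ exists sim : circle R -> circle R -> Prop,
       [/\ is_lamination sim, sigma_invariant sim, ~ degenerate_lam sim
         & sim theta theta']).
Proof.
move=> theta theta'; split.
  move=> sim lam inv nondeg sim0.
  have sim_refl x : sim x x by case: lam => -[].
  split.
  - exact: (same_itinerary_sim hper lam inv nondeg sim0).
  - exact: (geolam_infty_sim hper lam inv nondeg sim0).
  split.
  - exists 0; apply/seteqP; split=> [x -> //|x].
    exact: (zero_class_trivial hper lam inv nondeg sim0 ht).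
  - by rewrite image_set1; congr [set _]; rewrite /sigma mul0rn.
  move=> A AA; have [pA cA sA nA] := rotational_class hper lam inv nondeg sim0 AA.
  split => // A0.
  have A00 : A 0 by rewrite A0.
  have [_ sub _] := AA; rewrite /theta antipode_ang in sub.
  have [w []] := half_arc_lift (sub _ A00).
  rewrite -ang0 => /angP[m E] hw.
  have m1 : m < 1 by rewrite -(ltr_int R); lra.
  have m2 : - 1 < m by rewrite -(ltr_int R) mulrNz; lra.
  have m0 : m = 0 by clear - m1 m2; lia.
  apply: (nA _ A00); rewrite -ang0; have -> : 0 = t by rewrite m0 in E; lra.
  exact: sim_refl.
move=> [_ [A [AA Atheta]]] [sim [lam inv nondeg sim0]].
have [_ _ _ nA] := rotational_class hper lam inv nondeg sim0 AA.
have [[sim_refl sim_sym _] _ _ _] := lam.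
by case: Atheta => /nA; apply; [exact: sim_refl|exact: sim_sym].
Qed.
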